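(* Let $R$ be a one-dimensional Noetherian local domain with integral closure $\overline{R}$ (in its fraction field $K$) and conductor $\mathfrak{C}=R:_K\overline{R}$. Assume that the completion $\widehat{R}$ is reduced, that $\overline{R}$ is a DVR, and that $R$ has a canonical module $\omega$. Then for any non-zero ideal $J$ of $R$ the following are equivalent: (a) $h(J)=\lambda(R/J)$; (b) $\mathfrak{C}\subseteq x:_R(x:_R J)$ for some non-zero $x\in J$; (c) $\mathfrak{C}\omega\subseteq J\omega$. In particular, if $R$ is Gorenstein, then $\mathfrak{C}\subseteq J$ for any $J$ which realizes itself (that is, any non-zero ideal $J$ with $h(J)=\lambda(R/J)$). Thus, if $R$ is Gorenstein, then for any finitely generated $R$-module $M$ of positive rank, $h(M)\le h(\mathfrak{C})=\lambda(R/\mathfrak{C})$.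
   Context: $\lambda(\cdot)$ denotes length as an $R$-module. For $x\in R$ and an ideal $L$ of $R$, $x:_R L:=\{r\in R\mid rL\subseteq xR\}$; for $R$-submodules $A,B$ of $K$, $A:_K B:=\{\alpha\in K\mid \alpha B\subseteq A\}$. The conductor $\mathfrak{C}$ is the largest common ideal of $R$ and $\overline{R}$. Invariant $h$: for a finitely generated $R$-module $M$ of non-zero rank, $h(M):=\min\{\lambda(R/I)\mid I=\phi(M)\text{ for some }R\text{-homomorphism }\phi:M\to R\}$ (the zero map contributes $\infty$). For a non-zero ideal $J$ this is $h(J)=\min\{\lambda(R/I)\mid I\text{ an ideal of }R,\ I\cong J\}$. An ideal $J$ realizes $M$ if $M$ surjects onto $J$ and $h(M)=\lambda(R/J)$. *)

(* Defs.v *)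
From HB Require Import structures.
From mathcomp Require Import all_boot all_order all_algebra.
From mathcomp Require Import boolp classical_sets functions constructive_ereal.

Set Implicit Arguments.
Unset Strict Implicit.
Unset Printing Implicit Defensive.
Import Order.TTheory GRing.Theory Num.Theory.
Local Open Scope ring_scope.
Local Open Scope classical_set_scope.
Local Open Scope quotient_scope.

(* Submodules of [V] are terms of the library type [submodClosed V] and ideals
   of [R] are terms of [submodClosed R^o].  Lengths, dimensions, ranks and
   depths live in [\bar int], an infinite value being [+oo]. *)

Section Submodules.
Variables (R : comNzRingType) (V : lmodType R).

Definition submodule_set (P : set V) : Prop :=
  P 0 /\ forall (a : R) x y, P x -> P y -> P (a *: x + y).

Definition asmem (P : set V) : {pred V} := fun x => `[< P x >].

Lemma submod_closed_asmem (P : set V) :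
  submodule_set P -> submod_closed (asmem P).
Proof.
move=> [P0 PD]; split; first exact/asboolP.
by move=> a x y /asboolP Px /asboolP Py; apply/asboolP/PD.
Qed.

Definition Submodule (P : set V) (hP : submodule_set P) : submodClosed V :=
  HB.pack (asmem P)
    (GRing.isSubmodClosed.Build R V (asmem P) (submod_closed_asmem hP)).

Lemma in_Submodule (P : set V) (hP : submodule_set P) x :
  x \in Submodule hP <-> P x.
Proof. by split=> [/asboolP|?]; [|apply/asboolP]. Qed.

Lemma submodule_setT : submodule_set [set: V].
Proof. by []. Qed.

Definition full_submod : submodClosed V := Submodule submodule_setT.

Lemma submodule_set_submod_span (S : set V) : submodule_set
  [set x | forall W : submodClosed V, (forall s, S s -> s \in W) -> x \in W].
Proof.
split=> [W _|a x y hx hy W SW]; first exact: rpred0.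
by rewrite rpredD ?rpredZ ?hx ?hy.
Qed.

Definition submod_span (S : set V) : submodClosed V :=
  Submodule (submodule_set_submod_span S).

Definition submod_of (W : submodClosed V) := {x : V | x \in W}.

HB.instance Definition _ (W : submodClosed V) := SubChoice.on (submod_of W).
HB.instance Definition _ (W : submodClosed V) :=
  [SubChoice_isSubLmodule of submod_of W by <:].

(* The library quotient [Quotient.quot] asks for a [zmodClosed] predicate. *)
Definition submod_pred (W : submodClosed V) : {pred V} := fun x => x \in W.

Lemma submod_zmod_closed (W : submodClosed V) : zmod_closed (submod_pred W).
Proof.
split=> [|x y Wx Wy]; rewrite unfold_in /submod_pred; first exact: rpred0.
by rewrite -scaleN1r rpredD ?rpredZ.
Qed.

Definition zmod_of_submod (W : submodClosed V) : zmodClosed V :=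
  HB.pack (submod_pred W)
    (GRing.isZmodClosed.Build V (submod_pred W) (submod_zmod_closed W)).

Definition quot_mod (W : submodClosed V) := @Quotient.quot V (zmod_of_submod W).

Section QuotMod.
Variable W : submodClosed V.
Local Notation Q := (quot_mod W).

HB.instance Definition _ := GRing.Zmodule.on Q.

Definition proj_quot (x : V) : Q := \pi_(@Quotient.quot V (zmod_of_submod W)) x.

Lemma proj_quotK (q : Q) : proj_quot (repr q) = q.
Proof. exact: reprK. Qed.

Lemma proj_quot_eq x y : (proj_quot x = proj_quot y) <-> (x - y \in W).
Proof.
have -> : (x - y \in W) = (x - y \in zmod_of_submod W) by [].
by rewrite Quotient.idealrBE; split=> /eqP.
Qed.

Lemma proj_quotD x y : proj_quot (x + y) = proj_quot x + proj_quot y.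
Proof. by rewrite /proj_quot raddfD. Qed.

Lemma proj_quot0 : proj_quot 0 = 0.
Proof. by rewrite /proj_quot raddf0. Qed.

Definition scale_quot (a : R) (q : Q) : Q := proj_quot (a *: repr q).

Lemma proj_quotZ a x : proj_quot (a *: x) = scale_quot a (proj_quot x).
Proof.
by apply/proj_quot_eq; rewrite -scalerBr rpredZ //; apply/proj_quot_eq;
   rewrite proj_quotK.
Qed.

Lemma scale_quotA a b q : scale_quot a (scale_quot b q) = scale_quot (a * b) q.
Proof. by rewrite -(proj_quotK q) -!proj_quotZ scalerA. Qed.

Lemma scale_quot1 : left_id 1 scale_quot.
Proof. by move=> q; rewrite -(proj_quotK q) -proj_quotZ scale1r. Qed.

Lemma scale_quotDr : right_distributive scale_quot +%R.
Proof.
move=> a p q; rewrite -(proj_quotK p) -(proj_quotK q).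
by rewrite -proj_quotD -!proj_quotZ -proj_quotD scalerDr.
Qed.

Lemma scale_quotDl q : {morph scale_quot^~ q : a b / a + b}.
Proof.
by move=> a b; rewrite -(proj_quotK q) -!proj_quotZ -proj_quotD scalerDl.
Qed.

HB.instance Definition _ := GRing.Zmodule_isLmodule.Build R Q
  scale_quotA scale_quot1 scale_quotDr scale_quotDl.

End QuotMod.

End Submodules.

Section QuotRing.
Variables (R : comNzRingType) (I : submodClosed R^o).

Definition quot_ring := quot_mod I.

HB.instance Definition _ := GRing.Zmodule.on quot_ring.

Definition proj_ring (r : R) : quot_ring := proj_quot I (r : R^o).

Lemma proj_ringK (q : quot_ring) : proj_ring (repr q) = q.
Proof. exact: proj_quotK. Qed.

Lemma proj_ringD x y : proj_ring (x + y) = proj_ring x + proj_ring y.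
Proof. exact: proj_quotD. Qed.

Definition mul_quot (p q : quot_ring) : quot_ring :=
  proj_ring ((repr p : R) * (repr q : R)).

Lemma proj_ringM (x y : R) :
  proj_ring (x * y) = mul_quot (proj_ring x) (proj_ring y).
Proof.
apply/proj_quot_eq.
set x' := (repr (proj_ring x) : R); set y' := (repr (proj_ring y) : R).
have hx : (x - x' : R^o) \in I by apply/proj_quot_eq; rewrite proj_quotK.
have hy : (y - y' : R^o) \in I by apply/proj_quot_eq; rewrite proj_quotK.
have -> : (x * y - x' * y' : R^o) = (y *: (x - x' : R^o) + x' *: (y - y' : R^o)).
  rewrite /GRing.scale /= !mulrBr addrA (mulrC y x) (mulrC y x').
  by rewrite subrK.
by rewrite rpredD ?rpredZ.
Qed.

Lemma mul_quotA : associative mul_quot.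
Proof.
move=> p q r; rewrite -(proj_ringK p) -(proj_ringK q) -(proj_ringK r).
by rewrite -!proj_ringM mulrA.
Qed.

Lemma mul_quotC : commutative mul_quot.
Proof.
by move=> p q; rewrite -(proj_ringK p) -(proj_ringK q) -!proj_ringM mulrC.
Qed.

Lemma mul_quot1 : left_id (proj_ring 1) mul_quot.
Proof. by move=> p; rewrite -(proj_ringK p) -proj_ringM mul1r. Qed.

Lemma mul_quotDl : left_distributive mul_quot +%R.
Proof.
move=> p q r; rewrite -(proj_ringK p) -(proj_ringK q) -(proj_ringK r).
by rewrite -proj_ringD -!proj_ringM -proj_ringD mulrDl.
Qed.

HB.instance Definition _ := GRing.Zmodule_isComPzRing.Build quot_ring
  mul_quotA mul_quotC mul_quot1 mul_quotDl.

End QuotRing.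

Section DependentProduct.
Variables (I : Type) (A : I -> comPzRingType).

Definition dprod := forall i, A i.

HB.instance Definition _ := Choice.copy dprod (forall i, (A i : choiceType)).

Definition dprod_add (f g : dprod) : dprod := fun i => f i + g i.
Definition dprod_opp (f : dprod) : dprod := fun i => - f i.
Definition dprod_zero : dprod := fun i => 0.
Definition dprod_mul (f g : dprod) : dprod := fun i => f i * g i.
Definition dprod_one : dprod := fun i => 1.

Lemma dprod_addA : associative dprod_add.
Proof. by move=> *; apply: functional_extensionality_dep => i; apply: addrA. Qed.
Lemma dprod_addC : commutative dprod_add.
Proof. by move=> *; apply: functional_extensionality_dep => i; apply: addrC. Qed.
Lemma dprod_add0 : left_id dprod_zero dprod_add.
Proof. by move=> *; apply: functional_extensionality_dep => i; apply: add0r. Qed.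
Lemma dprod_addN : left_inverse dprod_zero dprod_opp dprod_add.
Proof. by move=> *; apply: functional_extensionality_dep => i; apply: addNr. Qed.

HB.instance Definition _ := GRing.isZmodule.Build dprod
  dprod_addA dprod_addC dprod_add0 dprod_addN.

Lemma dprod_mulA : associative dprod_mul.
Proof. by move=> *; apply: functional_extensionality_dep => i; apply: mulrA. Qed.
Lemma dprod_mulC : commutative dprod_mul.
Proof. by move=> *; apply: functional_extensionality_dep => i; apply: mulrC. Qed.
Lemma dprod_mul1 : left_id dprod_one dprod_mul.
Proof. by move=> *; apply: functional_extensionality_dep => i; apply: mul1r. Qed.
Lemma dprod_mulDl : left_distributive dprod_mul dprod_add.
Proof. by move=> *; apply: functional_extensionality_dep => i; apply: mulrDl. Qed.

HB.instance Definition _ := GRing.Zmodule_isComPzRing.Build dprod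
  dprod_mulA dprod_mulC dprod_mul1 dprod_mulDl.

End DependentProduct.

Section IdealProduct.
Variable R : comNzRingType.

Definition ideal_mul (V : lmodType R) (I : submodClosed R^o)
    (W : submodClosed V) : submodClosed V :=
  submod_span [set x | exists a v, [/\ a \in I, v \in W & x = a *: v]].

Definition ideal_exp (I : submodClosed R^o) (n : nat) : submodClosed R^o :=
  iter n (ideal_mul I) (full_submod R^o).

End IdealProduct.

Section Completion.
Variables (R : comNzRingType) (I : submodClosed R^o).

Definition adic_prod := dprod (fun n => quot_ring (ideal_exp I n)).

HB.instance Definition _ := GRing.ComPzRing.on adic_prod.

(* [x n.+1] maps to [x n] under the transition map R/I^(n+1) -> R/I^n. *)
Definition adic_coherent : {pred adic_prod} := fun x =>
  `[< forall n, exists r : R,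
        x n.+1 = proj_ring (ideal_exp I n.+1) r /\
        x n = proj_ring (ideal_exp I n) r >].

Lemma adic_coherent_subring : subring_closed adic_coherent.
Proof.
split=> [|x y /asboolP hx /asboolP hy|x y /asboolP hx /asboolP hy];
  apply/asboolP => n; first by exists 1.
  have [r [hr hr']] := hx n; have [s [hs hs']] := hy n.
  exists (r - s); rewrite !proj_ringD.
  have N J : proj_ring J (- s) = - proj_ring J s.
    by apply/eqP; rewrite -addr_eq0 -proj_ringD addNr; apply/eqP/proj_quot0.
  by split; rewrite N ?(hr, hr', hs, hs') -?(hr, hr', hs, hs').
have [r [hr hr']] := hx n; have [s [hs hs']] := hy n.
by exists (r * s); rewrite !proj_ringM -hr -hr' -hs -hs'.
Qed.

HB.instance Definition _ :=
  GRing.isSubringClosed.Build adic_prod adic_coherent adic_coherent_subring.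

(* The inverse limit of the rings R/I^n. *)
Definition completion := {x : adic_prod | x \in adic_coherent}.

HB.instance Definition _ := SubChoice.on completion.
HB.instance Definition _ := GRing.SubChoice_isSubComPzRing.Build
  adic_prod adic_coherent completion (subringClosedP _).

End Completion.

Definition reduced (A : pzRingType) : Prop :=
  forall (x : A) (n : nat), x ^+ n = 0 -> x = 0.

Section FinitenessAndDimension.
Variable R : comNzRingType.

Definition finitely_generated (M : lmodType R) : Prop :=
  exists s : seq M, forall x, x \in submod_span [set y | y \in s].

Definition noetherian : Prop :=
  forall I : submodClosed R^o, finitely_generated (submod_of I).

Definition prime_ideal (P : submodClosed R^o) : Prop :=
  (1 : R^o) \notin P /\ prime_idealr_closed (P : {pred R}).

Definition maximal_ideal (P : submodClosed R^o) : Prop :=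
  (1 : R^o) \notin P /\
  forall I : submodClosed R^o, {subset P <= I} -> (1 : R^o) \notin I -> I =i P.

(* [R] is local with maximal ideal [m]. *)
Definition local_ring (m : submodClosed R^o) : Prop :=
  maximal_ideal m /\
  forall n : submodClosed R^o, maximal_ideal n -> n =i m.

(* In N with infinity; the convention for the empty set is -oo. *)
Definition nat_sup (A : set nat) : \bar int :=
  supremum -oo%E [set (n%:Z)%:E | n in A].

Definition submod_lt (V : lmodType R) (A B : submodClosed V) : Prop :=
  {subset A <= B} /\ ~ {subset B <= A}.

(* Supremum of the lengths n of chains W_0 < ... < W_n of submodules in [P]. *)
Definition chain_height (V : lmodType R) (P : submodClosed V -> Prop) :
    \bar int :=
  nat_sup [set n | exists W : nat -> submodClosed V,
    (forall i, (i <= n)%N -> P (W i)) /\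
    (forall i, (i < n)%N -> submod_lt (W i) (W i.+1))].

Definition mod_length (M : lmodType R) : \bar int :=
  chain_height (fun _ : submodClosed M => True).

Definition krull_dim : \bar int := chain_height prime_ideal.

Definition mod_rank (M : lmodType R) : \bar int :=
  nat_sup [set n | exists v : 'I_n -> M,
    forall a : 'I_n -> R, \sum_i a i *: v i = 0 -> forall i, a i = 0].

Lemma submodule_set_image (M N : lmodType R) (phi : {linear M -> N}) :
  submodule_set (range phi).
Proof.
split=> [|a _ _ [x _ <-] [y _ <-]]; first by exists 0; rewrite ?linear0.
by exists (a *: x + y); rewrite ?linearP.
Qed.

Definition lin_image (M N : lmodType R) (phi : {linear M -> N}) :
  submodClosed N := Submodule (submodule_set_image phi).

(* The minimum is attained as soon as the set is nonempty, which it always is;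
   the zero map contributes the length of [R], which is +oo in positive
   dimension. *)
Definition h_inv (M : lmodType R) : \bar int :=
  infimum +oo%E [set mod_length (quot_mod (lin_image phi)) |
                   phi in [set: {linear M -> R^o}]].

End FinitenessAndDimension.

Section Homological.
Variable R : comNzRingType.

Definition isomorphic (M N : lmodType R) : Prop :=
  exists f : {linear M -> N}, bijective f.

Definition injective_module (E : lmodType R) : Prop :=
  forall (A B : lmodType R) (i : {linear A -> B}) (f : {linear A -> E}),
    injective i -> exists g : {linear B -> E}, forall x, g (i x) = f x.

Record injective_resolution (M : lmodType R) := InjectiveResolution {
  inj_term :> nat -> lmodType R;
  inj_aug : {linear M -> inj_term 0%N};
  inj_diff : forall n, {linear inj_term n -> inj_term n.+1};
  inj_termP : forall n, injective_module (inj_term n);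
  inj_aug_injective : injective inj_aug;
  inj_exact0 : forall y, inj_diff 0%N y = 0 <-> exists x, y = inj_aug x;
  inj_exactS : forall n y,
    inj_diff n.+1 y = 0 <-> exists x, y = inj_diff n x
}.

Definition finite_injective_dim (M : lmodType R) : Prop :=
  exists (E : injective_resolution M) (n : nat),
    forall i, (n < i)%N -> forall x : E i, x = 0.

(* Ext^n(A, M) is the n-th cohomology module of the complex Hom(A, E). *)
Section Ext.
Variables (A M : lmodType R) (E : injective_resolution M).

Definition cocycle_set (n : nat) : set (A -> E n) :=
  [set f | linear f /\ forall x, inj_diff E n (f x) = 0].

Definition coboundary_set (n : nat) : set (A -> E n) :=
  match n with
  | 0%N => [set 0]
  | n'.+1 => [set f | exists2 g : A -> E n',
                        linear g & forall x, f x = inj_diff E n' (g x)]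
  end.

Lemma linear_fct0 (U V : lmodType R) : linear (0 : U -> V).
Proof.
move=> b x y; have E0 z : (0 : U -> V) z = 0 by [].
by rewrite !E0 scaler0 addr0.
Qed.

Lemma linear_fctP (U V : lmodType R) (a : R) (f g : U -> V) :
  linear f -> linear g -> linear (a *: f + g).
Proof.
move=> lf lg b x y; have E1 z : (a *: f + g) z = a *: f z + g z by [].
by rewrite !E1 lf lg !scalerDr !scalerA addrACA mulrC.
Qed.

Lemma submodule_set_cocycle n : submodule_set (@cocycle_set n).
Proof.
split=> [|a f g [lf df] [lg dg]].
  by split=> [|x]; [exact: linear_fct0 | exact: linear0].
split=> [|x]; first exact: linear_fctP.
have -> : (a *: f + g) x = a *: f x + g x by [].
by rewrite linearP df dg scaler0 addr0.
Qed.

Definition cocycles (n : nat) : submodClosed (A -> E n) :=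
  Submodule (submodule_set_cocycle n).

Lemma submodule_set_coboundary n :
  submodule_set [set f : submod_of (cocycles n) | coboundary_set (val f)].
Proof.
case: n => [|n]; split=> /=.
- by [].
- move=> a f g hf hg.
  rewrite -[LHS]/(a *: sval f + sval g).
  by rewrite hf hg scaler0 addr0.
- exists 0 => [|x]; first exact: linear_fct0.
  have -> : (0 : A -> E n) x = 0 by [].
  by rewrite linear0.
- move=> a f g [f' lf hf] [g' lg hg].
  exists (a *: f' + g') => [|x]; first exact: linear_fctP.
  have -> : (a *: f' + g') x = a *: f' x + g' x by [].
  rewrite -[LHS]/(a *: sval f x + sval g x).
  by rewrite linearP hf hg.
Qed.

Definition coboundaries (n : nat) : submodClosed (submod_of (cocycles n)) :=
  Submodule (submodule_set_coboundary n).

Definition Ext (n : nat) : lmodType R := quot_mod (coboundaries n).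

End Ext.

Definition gen_ideal (x : seq R) : submodClosed R^o :=
  submod_span (fun r : R^o => (r : R) \in x).

Definition regular_seq (M : lmodType R) (x : seq R) : Prop :=
  let xM i := ideal_mul (gen_ideal (take i x)) (full_submod M) in
  (forall i, (i < size x)%N ->
     forall v : M, x`_i *: v \in xM i -> v \in xM i) /\
  exists v : M, v \notin xM (size x).

Definition depth (m : submodClosed R^o) (M : lmodType R) : \bar int :=
  nat_sup [set n | exists x : seq R,
    [/\ size x = n, {subset x <= (m : {pred R})} & regular_seq M x]].

Definition maximal_cohen_macaulay (m : submodClosed R^o) (M : lmodType R) :=
  finitely_generated M /\ depth m M = krull_dim R.

(* Ext^t(k, M), for t the depth of M, is a one-dimensional vector space over
   the residue field k. *)
Definition type_one (m : submodClosed R^o) (M : lmodType R) : Prop :=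
  exists2 t : nat, depth m M = (t%:Z)%:E &
    forall E : injective_resolution M,
      isomorphic (Ext (quot_mod m) E t) (quot_mod m).

(* Bruns and Herzog, Cohen-Macaulay rings, Definition 3.3.1. *)
Definition canonical_module (m : submodClosed R^o) (M : lmodType R) : Prop :=
  [/\ maximal_cohen_macaulay m M, type_one m M & finite_injective_dim M].

(* For a Noetherian local ring. *)
Definition gorenstein : Prop := finite_injective_dim R^o.

End Homological.

Section FractionField.
Variable R : idomainType.
Local Notation K := {fraction R}.

Definition integral_closure : set K := integralOver (@tofrac R).

(* [A] is the valuation ring of a discrete valuation on [K]; the value at 0 is
   irrelevant. *)
Definition is_dvr (A : set K) : Prop :=
  exists v : K -> int,
    [/\ forall n, exists2 x, x != 0 & v x = n,
        forall x y, x != 0 -> y != 0 -> v (x * y) = v x + v y,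
        forall x y, x != 0 -> y != 0 -> x + y != 0 ->
          Num.min (v x) (v y) <= v (x + y) &
        forall x, A x <-> x = 0 \/ 0 <= v x].

Definition colon_frac (A B : set K) : set K :=
  [set a | forall b, B b -> A (a * b)].

Definition colon_elt (x : R) (L : set R) : set R :=
  [set r | forall l, L l -> exists t, r * l = x * t].

Definition conductor_frac : set K :=
  colon_frac (range (@tofrac R)) integral_closure.

Lemma submodule_set_conductor :
  submodule_set (fun r : R^o => conductor_frac (@tofrac R r)).
Proof.
split=> [b _|a x y hx hy b hb]; first by exists 0 => //; rewrite !rmorph0 mul0r.
have [s _ hs] := hx b hb; have [t _ ht] := hy b hb.
exists (a * s + t) => //.
have -> : tofrac (a * s + t) = tofrac a * tofrac s + tofrac t.
  by rewrite rmorphD rmorphM.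
have -> : @tofrac R (a *: x + y : R^o) = tofrac a * @tofrac R x + @tofrac R y.
  by rewrite rmorphD rmorphM.
by rewrite hs ht mulrDl mulrA.
Qed.

(* The conductor as an ideal of [R]; no element is lost, since the conductor
   is contained in (the image of) [R]. *)
Definition conductor : submodClosed R^o := Submodule submodule_set_conductor.

Lemma conductor_fracE :
  conductor_frac = [set @tofrac R r | r in [set r : R | (r : R^o) \in conductor]].
Proof.
apply/seteqP; split=> [a ha|_ [r /=
    /(in_Submodule submodule_set_conductor) hr <-]]; first last.
  exact: hr.
have [r _ hr] := ha 1 (integral1 _); rewrite mulr1 in hr.
by exists r => //; apply/(in_Submodule submodule_set_conductor); rewrite hr.
Qed.

End FractionField.

(* Main.v *)
From HB Require Import structures.
Require Import Defs.
From mathcomp Require Import all_boot all_order all_algebra.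
From mathcomp Require Import boolp classical_sets functions constructive_ereal.
From mathcomp Require Import zify ring.

Set Implicit Arguments.
Unset Strict Implicit.
Unset Printing Implicit Defensive.
Import Order.TTheory GRing.Theory Num.Theory.
Local Open Scope ring_scope.

(** Let [K] be the fraction field, [Rbar] the integral closure and [C] the
    conductor.

    A non-zero homomorphism from [J] to [R] is multiplication by a fraction
    [a/b], and it changes the colength of [J] by the difference of the lengths of
    [R/aR] and [R/bR]. This difference has the sign of the value of [a/b], as one
    sees by comparing the ideals [a c Rbar] and [b c Rbar] for a fixed non-zero
    [c] in [C]. Hence [h(J)] is the colength of [J] if and only if the inverse
    [R : J] is contained in [Rbar] ([h_invE]). Since [C] is an ideal of [Rbar] one
    has [R : C = Rbar] ([conductor_colon_integral]), so this inclusion also means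
    that [C] is contained in [R : (R : J)], which is the double colon ideal of
    condition (b).

    Condition (c) becomes the same inclusion through the duality with values in
    the canonical module [omega]. A finite injective resolution gives, by dimension
    shifting, that the first cosyzygy is injective in the sense of Baer
    ([cosyzygy_injective]); this produces enough homomorphisms from an ideal to
    [omega] to separate it from larger ideals ([nonextendable_hom]). Type one says
    that the quotients [omega/y omega] have a simple socle, which bounds their
    lengths by those of [R/yR] and forces [omega] to have rank one
    ([embeds_in_ring]). So [omega] is isomorphic to an ideal, its submodules are
    reflexive, and the duals of [C omega] and [J omega] are [Rbar] and [R : J]; hence
    [C omega] is contained in [J omega] exactly when [R : J] is contained in [Rbar].
    For a Gorenstein ring the same duality with values in [R] gives
    [J = R : (R : J)], which then contains [C]; a module [M] of positive rank
    surjects onto an ideal realizing both [M] and itself ([realizing_ideal]), whence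
    the bound on [h(M)].

    All this requires [C] to be non-zero, which is where the completion enters
    ([conductor_nonzero]). If [C] were zero, no integral closure of a power of
    [xR], for [x] in the maximal ideal, would be contained in [xR], and a limit of
    elements of these integral closures would be a non-zero element of the
    completion. It would be nilpotent: integral fractions satisfy equations of
    bounded degree, because every ideal is generated by a bounded number of
    elements ([generator_bound]). *)

(** * Submodules and the length of a subquotient *)

Section SubmoduleOperations.
Variables (R : comNzRingType) (V : lmodType R).
Implicit Types (A B C U : submodClosed V) (r : R) (v w x : V).

Lemma in_SubmoduleP (P : set V) (hP : submodule_set P) x :
  reflect (P x) (x \in Submodule hP).
Proof. exact: asboolP. Qed.

Lemma submodN A x : x \in A -> - x \in A.
Proof. by move=> Ax; rewrite -scaleN1r rpredZ. Qed.

Lemma submodB A x y : x \in A -> y \in A -> x - y \in A.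
Proof. by move=> Ax Ay; rewrite rpredD ?submodN. Qed.

Lemma submodule_set_add A B :
  submodule_set (fun x => exists a b, [/\ a \in A, b \in B & x = a + b]).
Proof.
split=> [|r _ _ [a [b [Aa Bb ->]]] [c [d [Ac Bd ->]]]].
  by exists 0, 0; rewrite !rpred0 addr0.
exists (r *: a + c), (r *: b + d); split; rewrite ?rpredD ?rpredZ //.
by rewrite scalerDr addrACA.
Qed.
Definition sub_add A B := Submodule (submodule_set_add A B).

Lemma sub_addP A B x :
  reflect (exists a b, [/\ a \in A, b \in B & x = a + b]) (x \in sub_add A B).
Proof. exact: in_SubmoduleP. Qed.

Lemma sub_addl A B : {subset A <= sub_add A B}.
Proof. by move=> x Ax; apply/sub_addP; exists x, 0; rewrite rpred0 addr0. Qed.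

Lemma sub_addr A B : {subset B <= sub_add A B}.
Proof. by move=> x Ax; apply/sub_addP; exists 0, x; rewrite rpred0 add0r. Qed.

Lemma sub_add_min A B C :
  {subset A <= C} -> {subset B <= C} -> {subset sub_add A B <= C}.
Proof.
move=> AC BC _ /sub_addP[a [b [Aa Bb ->]]].
by apply: rpredD; [apply: AC|apply: BC].
Qed.

Lemma submodule_set_cap A B : submodule_set (fun x => x \in A /\ x \in B).
Proof.
split=> [|r x y [Ax Bx] [Ay By]]; first by split; apply: rpred0.
by split; apply: rpredD => //; apply: rpredZ.
Qed.
Definition sub_cap A B := Submodule (submodule_set_cap A B).

Lemma sub_capP A B x :
  reflect (x \in A /\ x \in B) (x \in sub_cap A B).
Proof. exact: in_SubmoduleP. Qed.

Lemma submodule_set_line v : submodule_set (fun x => exists r, x = r *: v).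
Proof.
split=> [|r _ _ [a ->] [b ->]]; first by exists 0; rewrite scale0r.
by exists (r * a + b); rewrite scalerDl scalerA.
Qed.
Definition line v := Submodule (submodule_set_line v).

Lemma lineP v x : reflect (exists r, x = r *: v) (x \in line v).
Proof. exact: in_SubmoduleP. Qed.

Lemma line_id v : v \in line v.
Proof. by apply/lineP; exists 1; rewrite scale1r. Qed.

Definition adjoin A v := sub_add A (line v).

Lemma adjoinP A v x :
  reflect (exists a r, a \in A /\ x = a + r *: v) (x \in adjoin A v).
Proof.
apply: (iffP (sub_addP _ _ _)).
  by move=> [a [_ [Aa /lineP[r ->] ->]]]; exists a, r.
move=> [a [r [Aa ->]]]; exists a, (r *: v); split=> //.
by apply/lineP; exists r.
Qed.

Lemma adjoin_sub A v : {subset A <= adjoin A v}.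
Proof. exact: sub_addl. Qed.

Lemma adjoin_id A v : v \in adjoin A v.
Proof. exact/sub_addr/line_id. Qed.

Lemma adjoin_min A v C :
  {subset A <= C} -> v \in C -> {subset adjoin A v <= C}.
Proof.
move=> AC Cv; apply: sub_add_min => // _ /lineP[r ->].
exact: rpredZ.
Qed.

Lemma submodule_set_scale r A : submodule_set (fun x => exists2 a, a \in A & x = r *: a).
Proof.
split=> [|s _ _ [a Aa ->] [b Ab ->]]; first by exists 0; rewrite ?rpred0 ?scaler0.
exists (s *: a + b); first by rewrite rpredD ?rpredZ.
by rewrite scalerDr !scalerA mulrC.
Qed.
Definition sub_scale r A := Submodule (submodule_set_scale r A).

Lemma sub_scaleP r A x :
  reflect (exists2 a, a \in A & x = r *: a) (x \in sub_scale r A).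
Proof. exact: in_SubmoduleP. Qed.

Lemma sub_scale_sub r A : {subset sub_scale r A <= A}.
Proof. by move=> _ /sub_scaleP[a Aa ->]; rewrite rpredZ. Qed.

Lemma in_full x : x \in full_submod V.
Proof. exact/in_SubmoduleP. Qed.

Lemma submodule_set0 : submodule_set (fun x : V => x = 0).
Proof. by split=> [//|r _ _ -> ->]; rewrite scaler0 addr0. Qed.
Definition zero_submod := Submodule submodule_set0.

Lemma in_zero x : reflect (x = 0) (x \in zero_submod).
Proof. exact: in_SubmoduleP. Qed.

Lemma submod_lt_witness A B :
  {subset A <= B} -> forall x, x \in B -> x \notin A -> submod_lt A B.
Proof. by move=> AB x Bx nAx; split=> // /(_ _ Bx); rewrite (negPf nAx). Qed.

Lemma not_subset (A B : {pred V}) :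
  ~ {subset A <= B} -> exists2 x, x \in A & x \notin B.
Proof.
by move=> /existsNP[x /not_implyP[Ax /negP nBx]]; exists x.
Qed.

Lemma span_min (S : set V) C :
  (forall s, S s -> s \in C) -> {subset submod_span S <= C}.
Proof. by move=> SC x /in_SubmoduleP; apply. Qed.

Lemma span_gen (S : set V) s : S s -> s \in submod_span S.
Proof. by move=> Ss; apply/in_SubmoduleP => W; apply. Qed.

(** Lower bounds on the length of [B/A], for [A] contained in [B]. Recursion on
    the last step of a chain avoids any manipulation of indexed chains. *)
Fixpoint length_ge n A B : Prop :=
  if n is n'.+1 then exists2 U, length_ge n' A U & submod_lt U B
  else {subset A <= B}.

Lemma length_ge_sub n A B : length_ge n A B -> {subset A <= B}.
Proof.
elim: n B => [//|n IH] B /= [U /IH AU [UB _]] x Ax.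
exact/UB/AU.
Qed.

Lemma length_ge_widenr n A B C :
  length_ge n A B -> {subset B <= C} -> length_ge n A C.
Proof.
case: n => [|n] /=; first by move=> AB BC x /AB/BC.
move=> [U hU [UB nBU]] BC; exists U => //; split=> [x /UB/BC //|CU].
by apply: nBU => x /BC/CU.
Qed.

Lemma length_ge_widenl n A B C :
  length_ge n B C -> {subset A <= B} -> length_ge n A C.
Proof.
elim: n C => [|n IH] C /=; first by move=> BC AB x /AB/BC.
by move=> [U hU UC] AB; exists U => //; apply: IH.
Qed.

Lemma length_ge_le n k A B : length_ge n A B -> (k <= n)%N -> length_ge k A B.
Proof.
elim: n B => [|n IH] B; first by rewrite leqn0 => ? /eqP->.
move=> h; rewrite leq_eqVlt => /orP[/eqP-> //|]; rewrite ltnS => kn.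
by case: h => U /IH-/(_ kn) hU [UB _]; apply: length_ge_widenr hU UB.
Qed.

Lemma length_geD p q A B C :
  length_ge p A B -> length_ge q B C -> length_ge (p + q) A C.
Proof.
move=> hp; elim: q C => [|q IH] C /=.
  by rewrite addn0 => BC; apply: length_ge_widenr hp BC.
by rewrite addnS => -[U hU UC]; exists U => //; apply: IH.
Qed.

(** Additivity of length, upper bound: by the modular law, every strict step
    [U < U'] of a chain is strict after intersecting with [B] or after adding
    [B]. *)
Lemma length_ge_split n A B C :
  length_ge n A C -> {subset A <= B} ->
  exists p q, [/\ (p + q = n)%N, length_ge p A (sub_cap C B) &
                  length_ge q B (sub_add C B)].
Proof.
elim: n C => [|n IH] C /=.
  move=> AC AB; exists 0, 0; split=> //= x; last exact: sub_addr.
  by move=> Ax; apply/sub_capP; split; [apply: AC|apply: AB].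
move=> [U hU [UC nCU]] AB; have [p [q [<- hp hq]]] := IH _ hU AB.
have UCcap : {subset sub_cap U B <= sub_cap C B}.
  by move=> x /sub_capP[/UC Cx Bx]; apply/sub_capP; split.
have UCadd : {subset sub_add U B <= sub_add C B}.
  by apply: sub_add_min => x xU; [apply/sub_addl/UC|apply/sub_addr].
have [h|h] := pselect ({subset sub_cap C B <= sub_cap U B}); last first.
  exists p.+1, q; split=> //; first by exists (sub_cap U B).
  exact: length_ge_widenr hq UCadd.
exists p, q.+1; split; first by rewrite addnS.
  exact: length_ge_widenr hp UCcap.
exists (sub_add U B) => //; split=> // CU.
apply: nCU => c Cc; have /CU/sub_addP[u [b [Uu Bb cE]]] := sub_addl B Cc.
have : b \in sub_cap C B.
  have bE : b = c - u by rewrite cE addrAC subrr add0r.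
  by apply/sub_capP; split=> //; rewrite bE; apply: submodB; last exact: UC.
by move/h/sub_capP => [Ub _]; rewrite cE rpredD.
Qed.

Definition length_is A B n := length_ge n A B /\ ~ length_ge n.+1 A B.

Lemma length_isP n A B : length_is A B n -> forall k, length_ge k A B <-> (k <= n)%N.
Proof.
move=> [h nh] k; split=> [hk|]; last exact: length_ge_le.
by rewrite leqNgt; apply/negP => nk; apply: nh; apply: length_ge_le hk nk.
Qed.

Lemma length_is_uniq n k A B : length_is A B n -> length_is A B k -> n = k.
Proof.
move=> hn hk; apply/eqP; rewrite eqn_leq; apply/andP; split.
  by apply/(length_isP hk); case: hn.
by apply/(length_isP hn); case: hk.
Qed.

Lemma length_isD p q A B C :
  length_is A B p -> length_is B C q -> length_is A C (p + q).
Proof.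
move=> [hp np] [hq nq]; split; first exact: length_geD hp hq.
have AB := length_ge_sub hp; have BC := length_ge_sub hq.
move=> h; have [p' [q' [e hp' hq']]] := length_ge_split h AB.
have p'p : (p' <= p)%N.
  apply/(length_isP (conj hp np)); apply: length_ge_widenr hp' _.
  by move=> x /sub_capP[].
have q'q : (q' <= q)%N.
  apply/(length_isP (conj hq nq)); apply: length_ge_widenr hq' _.
  exact: sub_add_min.
by have := leq_add p'p q'q; rewrite e ltnn.
Qed.

Lemma length_is_exists N A B : {subset A <= B} -> ~ length_ge N A B ->
  exists n, length_is A B n.
Proof.
elim: N => [//|N IH] AB nh.
by have [h|/(IH AB)] := pselect (length_ge N A B); first by exists N.
Qed.

Lemma length_is_eq A B : {subset A <= B} -> {subset B <= A} -> length_is A B 0.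
Proof.
move=> AB BA; split=> //= -[U AU [UB nBU]]; apply: nBU => x /BA.
exact: AU.
Qed.

Lemma length_is_lt0 n A B : length_is A B n -> submod_lt A B -> (0 < n)%N.
Proof.
by move=> /length_isP h AB; apply/h => /=; exists A.
Qed.

Lemma length_is_step A B :
  submod_lt A B ->
  (forall U, {subset A <= U} -> submod_lt U B -> {subset U <= A}) ->
  length_is A B 1.
Proof.
move=> [AB nBA] h; split; first by exists A.
move=> [U [U' AU' [U'U nUU']] UB].
by apply: nUU' => x /h-/(_ _ UB) Ax; apply/AU'/Ax => y /AU'/U'U.
Qed.

End SubmoduleOperations.

(** This transports chains along multiplication by a ring element and along
    [U |-> A + U v], which turns ideals into submodules of a module. *)
Lemma length_ge_map (R R' : comNzRingType) (V : lmodType R) (V' : lmodType R')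
    (F : submodClosed V -> submodClosed V') (A B : submodClosed V) n :
  (forall U U' : submodClosed V, {subset A <= U} -> {subset U' <= B} ->
     {subset U <= U'} -> {subset F U <= F U'}) ->
  (forall U U' : submodClosed V, {subset A <= U} -> {subset U' <= B} ->
     submod_lt U U' -> ~ {subset F U' <= F U}) ->
  length_ge n A B -> length_ge n (F A) (F B).
Proof.
move=> mono strict.
suff: forall C : submodClosed V, {subset C <= B} -> length_ge n A C -> length_ge n (F A) (F C).
  exact.
elim: n => [|n IH] C CB /=; first exact: mono.
move=> [U hU [UC nCU]]; have AU := length_ge_sub hU.
have UB : {subset U <= B} by move=> x /UC/CB.
exists (F U); first exact: IH.
by split; [exact: mono|exact: strict].
Qed.

(** * Lengths of quotient modules and the invariant [h] *)

Section NatSup.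
Local Open Scope classical_set_scope.
Local Open Scope ereal_scope.

Local Notation "n %:X" := ((n%:Z)%:E) (at level 2).

Lemma nat_sup_nonempty (A : set nat) : A !=set0 ->
  supremums [set n%:X | n in A] !=set0.
Proof.
move=> [n0 An0].
have [[N hN]|unb] := pselect (exists N, forall n, A n -> (n <= N)%N).
  have ex : exists n, `[< A n >] by exists n0; apply/asboolP.
  have ub n : `[< A n >] -> (n <= N)%N by move=> /asboolP; apply: hN.
  have [M /asboolP AM maxM] := ex_maxnP ex ub.
  exists M%:X; split=> [_ [n An <-]|y]; last by apply; exists M.
  by rewrite lee_fin lez_nat maxM //; apply/asboolP.
exists +oo; split=> [y _|y hy]; first exact: leey.
case: y hy => [z| |] hy //.
  case: unb; exists `|z|%N => n An.
  have : n%:X <= z%:E by apply: hy; exists n.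
  by rewrite lee_fin -lez_nat; lia.
by have := hy n0%:X; rewrite leeNy_eq => h; have /eqP := h (ex_intro2 _ _ _ An0 erefl).
Qed.

Lemma nat_sup_ge (A : set nat) n : A n -> n%:X <= nat_sup A.
Proof.
move=> An; apply: ge_supremum_Nmem; last by exists n.
by apply: nat_sup_nonempty; exists n.
Qed.

Lemma nat_sup_le (A : set nat) y : A !=set0 -> (forall n, A n -> n%:X <= y) ->
  nat_sup A <= y.
Proof.
move=> A0 hy; rewrite /nat_sup /supremum ifF; last first.
  apply/negP => /eqP h; case: A0 => n An.
  have : [set n%:X | n in A] n%:X by exists n.
  by rewrite h.
have [_ -> [_ h]|h] := xgetP; last first.
  by have [z /h] := nat_sup_nonempty A0.
by apply: h => _ [n An <-]; apply: hy.
Qed.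

Lemma nat_sup_bound (A : set nat) N n : nat_sup A = N%:X -> A n -> (n <= N)%N.
Proof. by move=> h /nat_sup_ge; rewrite h lee_fin lez_nat. Qed.

Lemma nat_sup_mem (A : set nat) N : nat_sup A = N%:X -> A N.
Proof.
move=> h; have A0 : A !=set0.
  apply/set0P/eqP => A0; move: h.
  by rewrite /nat_sup A0 image_set0 supremum0.
 apply: contrapT => nAN.
have [n0 An0] := A0; have n0N := nat_sup_bound h An0.
have Npos : (0 < N)%N.
  by case: (posnP N) => // N0; move: nAN; rewrite N0 in n0N *; move: n0N;
     rewrite leqn0 => /eqP <-.
have : nat_sup A <= N.-1%:X.
  apply: nat_sup_le => // n An; rewrite lee_fin lez_nat.
  have := nat_sup_bound h An; rewrite leq_eqVlt => /orP[/eqP nN|]; last by lia.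
  by case: nAN; rewrite -nN.
by rewrite h lee_fin lez_nat; lia.
Qed.

End NatSup.

Section QuotientLength.
Local Open Scope classical_set_scope.
Variables (R : comNzRingType) (V : lmodType R) (I : submodClosed V).

Lemma submodule_set_preimage_quot (W : submodClosed (quot_mod I)) :
  submodule_set (fun x => proj_quot I x \in W).
Proof.
split=> [|a x y Wx Wy]; first by rewrite proj_quot0 rpred0.
by rewrite proj_quotD proj_quotZ rpredD // [scale_quot _ _](_ : _ = a *: proj_quot I x) // rpredZ.
Qed.
Let pre W := Submodule (submodule_set_preimage_quot W).

Let preP (W : submodClosed (quot_mod I)) x : reflect (proj_quot I x \in W) (x \in pre W).
Proof. exact: in_SubmoduleP. Qed.

Lemma submodule_set_image_quot (W : submodClosed V) :
  submodule_set (fun q => exists2 x, x \in W & q = proj_quot I x).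
Proof.
split=> [|a _ _ [x Wx ->] [y Wy ->]]; first by exists 0; rewrite ?rpred0 ?proj_quot0.
by exists (a *: x + y); rewrite ?rpredD ?rpredZ // proj_quotD proj_quotZ.
Qed.
Let img W := Submodule (submodule_set_image_quot W).

Let imgP (W : submodClosed V) q : reflect (exists2 x, x \in W & q = proj_quot I x) (q \in img W).
Proof. exact: in_SubmoduleP. Qed.

Lemma length_ge_chain n (A B : submodClosed V) : length_ge n A B ->
  exists W : nat -> submodClosed V, [/\ forall i, {subset A <= W i},
    forall i, (i < n)%N -> submod_lt (W i) (W i.+1) & W n = B].
Proof.
elim: n B => [|n IH] B /=; first by exists (fun=> B).
move=> [U hU UB]; have AU := length_ge_sub hU; have [W [hW ltW WU]] := IH _ hU.
exists (fun i => if (i <= n)%N then W i else B); split=> [i|i|]; last by rewrite ltnn.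
  by case: ifP => // _ x /AU; case: UB => UB _; apply: UB.
rewrite ltnS => i_n; rewrite i_n; case: ltnP => [/ltW//|n_i].
have -> : i = n by apply/eqP; rewrite eqn_leq i_n n_i.
by rewrite WU.
Qed.

Lemma quot_chainP n :
  (exists W : nat -> submodClosed (quot_mod I),
    (forall i, (i <= n)%N -> True) /\
    (forall i, (i < n)%N -> submod_lt (W i) (W i.+1))) <->
  length_ge n I (full_submod V).
Proof.
split=> [[W [_ ltW]]|/length_ge_chain[W [IW ltW _]]].
  suff h : forall k, (k <= n)%N -> length_ge k I (pre (W k)).
    by apply: length_ge_widenr (h n (leqnn n)) _ => x _; apply: in_full.
  elim=> [_ x Ix|k IH kn] /=.
    apply/preP; have -> : proj_quot I x = 0; last exact: rpred0.
    by rewrite -(proj_quot0 I); apply/proj_quot_eq; rewrite subr0.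
  exists (pre (W k)); first by apply: IH; apply: ltnW.
  have [sub nsub] := ltW _ kn; split=> [x /preP Wx|h].
    exact/preP/sub.
  apply: nsub => q; rewrite -(proj_quotK q) => Wq.
  by have /h/preP : repr q \in pre (W k.+1) by apply/preP.
exists (fun i => img (W i)); split=> // i /ltW[sub nsub].
split=> [_ /imgP[x Wx ->]|h].
  by apply/imgP; exists x => //; apply: sub.
apply: nsub => x Wx.
have /h/imgP[y Wy /proj_quot_eq Ixy] : proj_quot I x \in img (W i.+1).
  by apply/imgP; exists x.
by rewrite -(subrK y x) rpredD // IW.
Qed.

Lemma quot_chain_nonempty :
  [set n | exists W : nat -> submodClosed (quot_mod I),
    (forall i, (i <= n)%N -> True) /\
    (forall i, (i < n)%N -> submod_lt (W i) (W i.+1))] !=set0.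
Proof. by exists 0%N; apply/quot_chainP => x _; apply: in_full. Qed.

Lemma mod_length_quotE n : length_is I (full_submod V) n ->
  mod_length (quot_mod I) = (n%:Z)%:E.
Proof.
move=> hn; apply/eqP; rewrite eq_le; apply/andP; split.
  apply: nat_sup_le; first exact: quot_chain_nonempty.
  by move=> k /quot_chainP /(length_isP hn); rewrite lee_fin lez_nat.
by apply: nat_sup_ge; apply/quot_chainP; case: hn.
Qed.

Lemma mod_length_quot_infinite : (forall n, length_ge n I (full_submod V)) ->
  mod_length (quot_mod I) = +oo%E.
Proof.
move=> hI; apply/eqP; rewrite -leye_eq.
suff h n : ((n%:Z)%:E <= mod_length (quot_mod I))%E.
  case E : (mod_length (quot_mod I)) (h 0%N) => [z| |] // _.
  by have := h `|z|.+1; rewrite E lee_fin => ?; exfalso; lia.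
by apply: nat_sup_ge; apply/quot_chainP.
Qed.

Lemma mod_length_quot_dichotomy :
  mod_length (quot_mod I) = +oo%E \/
  exists2 n, length_is I (full_submod V) n & mod_length (quot_mod I) = (n%:Z)%:E.
Proof.
have [h|/existsNP[N hN]] := pselect (forall n, length_ge n I (full_submod V)).
  by left; apply: mod_length_quot_infinite.
have [n hn] := length_is_exists (fun x _ => in_full x) hN.
by right; exists n => //; apply: mod_length_quotE.
Qed.

End QuotientLength.

Lemma mod_length_quot_le (R : comNzRingType) (V : lmodType R) (A B : submodClosed V) :
  {subset A <= B} -> (mod_length (quot_mod B) <= mod_length (quot_mod A))%E.
Proof.
move=> AB; have [->|[n hn ->]] := mod_length_quot_dichotomy A; first exact: leey.
have [hB|[k hk ->]] := mod_length_quot_dichotomy B.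
  have [_] := hn; case; apply: length_ge_widenl AB.
  apply: contrapT => hn1; have [k hk] := length_is_exists (fun x _ => in_full x) hn1.
  by have := mod_length_quotE hk; rewrite hB.
rewrite lee_fin lez_nat; apply/(length_isP hn).
by apply: length_ge_widenl (proj1 hk) AB.
Qed.

Lemma linear_map (R : comNzRingType) (U V : lmodType R) (f : U -> V) :
  linear f -> exists phi : {linear U -> V}, forall x, phi x = f x.
Proof.
move=> lf; pose phi : {linear U -> V} := HB.pack f (GRing.isLinear.Build R U V _ f lf).
by exists phi.
Qed.

Lemma lin_imageP (R : comNzRingType) (M : lmodType R) (phi : {linear M -> R^o}) (y : R) :
  reflect (exists x, phi x = y) (y \in lin_image phi).
Proof.
apply: (iffP (in_SubmoduleP (submodule_set_image phi) y)).
  by move=> [x _ <-]; exists x.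
by move=> [x <-]; exists x.
Qed.

Section HInvariant.
Variables (R : comNzRingType) (M : lmodType R).

Local Notation len phi := (mod_length (quot_mod (lin_image phi))).

(** Lengths are well ordered, so the infimum defining [h_inv] is a minimum. *)
Lemma h_inv_attained : exists phi : {linear M -> R^o}, h_inv M = len phi /\
  forall psi : {linear M -> R^o}, (len phi <= len psi)%E.
Proof.
suff [phi hphi] : exists phi : {linear M -> R^o},
    forall psi : {linear M -> R^o}, (len phi <= len psi)%E.
  exists phi; split=> //.
  have mem : [set len phi | phi in [set: {linear M -> R^o}]]%classic (len phi).
    by exists phi.
  have inf : infimums [set len phi | phi in [set: {linear M -> R^o}]]%classic (len phi).
    by split=> [_ [psi _ <-]//|y]; apply.
  rewrite /h_inv /infimum ifF; last first.
    by apply/negP => /eqP h; move: mem; rewrite h.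
  case: xgetP => [_ -> inf'|/(_ _ inf)//].
  exact: is_subset1_infimums inf' inf.
have [[phi [n hn]]|hinf] := pselect (exists (phi : {linear M -> R^o}) (n : nat),
    len phi = (n%:Z)%:E).
  have ex : exists n : nat, `[< exists phi : {linear M -> R^o}, len phi = (n%:Z)%:E >].
    by exists n; apply/asboolP; exists phi.
  have [k /asboolP[phi0 hphi0] mink] := ex_minnP ex.
  exists phi0 => psi; rewrite hphi0.
  have [->|[l _ hl]] := mod_length_quot_dichotomy (lin_image psi); first exact: leey.
  by rewrite hl lee_fin lez_nat mink //; apply/asboolP; exists psi.
exists (\0%R : {linear M -> R^o}) => psi.
have [->|[l _ hl]] := mod_length_quot_dichotomy (lin_image psi); first exact: leey.
by case: hinf; exists psi, l.
Qed.

Lemma h_invP L : (h_inv M = L) <->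
  (exists phi : {linear M -> R^o}, L = len phi) /\
  forall psi : {linear M -> R^o}, (L <= len psi)%E.
Proof.
have [phi [-> hphi]] := h_inv_attained; split=> [<-|]; first by split; first by exists phi.
by move=> [[psi ->] h]; apply/eqP; rewrite eq_le hphi h.
Qed.

End HInvariant.

(*CUT*)

(** * One-dimensional Noetherian local domains *)

Section LocalRing.
Variables (R : idomainType) (m : submodClosed R^o).
Hypothesis R_noetherian : noetherian R.
Hypothesis R_local : local_ring m.
Hypothesis R_dim1 : krull_dim R = 1%:E.

Implicit Types (I J A B : submodClosed R^o) (x y r s : R).

Lemma ideal_mull I r x : x \in I -> r * x \in I.
Proof. exact: (@rpredZ R R^o I r x). Qed.

Lemma ideal_mulr I r x : x \in I -> x * r \in I.
Proof. by rewrite mulrC; apply: ideal_mull. Qed.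

Lemma ideal0 I : (0 : R) \in I.
Proof. exact: (@rpred0 R^o I). Qed.

Lemma ideal_add I x y : x \in I -> y \in I -> x + y \in I.
Proof. exact: (@rpredD R^o I x y). Qed.

Lemma ideal_opp I x : x \in I -> - x \in I.
Proof. exact: (@submodN R R^o I x). Qed.

Lemma ideal_sub I x y : x \in I -> y \in I -> x - y \in I.
Proof. exact: (@submodB R R^o I x y). Qed.

Lemma ideal_full I : 1 \in I -> forall x, x \in I.
Proof. by move=> I1 x; rewrite -[x]mulr1; apply: ideal_mull. Qed.

Lemma pidealP x y : reflect (exists r, x = y * r) (x \in (line (y : R^o))).
Proof.
by apply: (iffP (lineP _ _)) => -[r ->]; exists r; rewrite /GRing.scale /= mulrC.
Qed.

Lemma pideal_min I y : y \in I -> {subset line (y : R^o) <= I}.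
Proof. by move=> Iy _ /pidealP[r ->]; apply: ideal_mulr. Qed.

Lemma noetherian_chain (W : nat -> submodClosed R^o) :
  (forall i, {subset W i <= W i.+1}) -> exists n, forall i, {subset W i <= W n}.
Proof.
move=> WS; have W_le i j : (i <= j)%N -> {subset W i <= W j}.
  elim: j => [|j IH]; first by rewrite leqn0 => /eqP->.
  by rewrite leq_eqVlt => /orP[/eqP->//|/IH h x /h]; apply: WS.
have UP : submodule_set (fun x : R^o => exists i, x \in W i).
  split=> [|a x y [i Wx] [j Wy]]; first by exists 0%N; apply: rpred0.
  exists (maxn i j); rewrite rpredD ?rpredZ //.
    exact: W_le (leq_maxl _ _) _ Wx.
  exact: W_le (leq_maxr _ _) _ Wy.
have [s sP] := R_noetherian (Submodule UP).
have [n hn] : exists n, forall t, t \in s -> \val t \in W n.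
  elim: s {sP} => [|t s [n hn]]; first by exists 0%N.
  have /in_SubmoduleP[i Wi] := valP t.
  exists (maxn i n) => u; rewrite inE => /orP[/eqP->|/hn].
    exact: W_le (leq_maxl _ _) _ Wi.
  by apply: W_le; apply: leq_maxr.
have CP : submodule_set (fun t : submod_of (Submodule UP) => \val t \in W n).
  split=> [|a x y Wx Wy]; first exact: rpred0.
  by rewrite -[\val _]/(a *: \val x + \val y) rpredD ?rpredZ.
exists n => i x Wx.
have Ux : x \in Submodule UP by apply/in_SubmoduleP; exists i.
suff /(_ (exist _ x Ux)) : forall t, t \in Submodule CP by move=> /in_SubmoduleP.
move=> t; apply: span_min (sP t) => u us; apply/in_SubmoduleP; exact: hn.
Qed.

Lemma noetherian_ind (P : submodClosed R^o -> Prop) :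
  (forall I, (forall J, submod_lt I J -> P J) -> P I) -> forall I, P I.
Proof.
move=> step I; apply: contrapT => nPI.
have next (t : {J | ~ P J}) : {t' : {J | ~ P J} | submod_lt (sval t) (sval t')}.
  apply: cid; case: t => J nPJ /=; apply: contrapT => h.
  apply: nPJ; apply: step => J' JJ'; apply: contrapT => nPJ'.
  by apply: h; exists (exist _ J' nPJ').
pose W i := sval (iter i (fun t => sval (next t)) (exist _ I nPI)).
have ltW i : submod_lt (W i) (W i.+1) by rewrite /W iterS; case: (next _).
have [n hn] := noetherian_chain (fun i => proj1 (ltW i)).
by have [_] := ltW n; apply; apply: hn.
Qed.

Lemma proper_sub_max I : 1 \notin I -> {subset I <= m}.
Proof.
elim/noetherian_ind: I => I IH nI1.
have [maxI|nmaxI] := pselect (maximal_ideal I).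
  by move=> x; rewrite (proj2 R_local _ maxI).
have [J [IJ nJ1 nJI]] : exists J, [/\ {subset I <= J}, 1 \notin J & ~ J =i I].
  apply: contrapT => h; apply: nmaxI; split=> // J IJ nJ1.
  by apply: contrapT => nJI; apply: h; exists J.
have ltIJ : submod_lt I J.
  by split=> // JI; apply: nJI => x; apply/idP/idP => [/JI|/IJ].
by move=> x /IJ; apply: IH.
Qed.

Lemma max_proper : 1 \notin m.
Proof. by case: R_local => -[]. Qed.

Lemma notin_max_unit r : r \notin m -> exists s, r * s = 1.
Proof.
move=> nr; have [/pidealP[s]|h] := boolP (1 \in line (r : R^o)); first by exists s.
by have := proper_sub_max h (line_id _); rewrite (negPf nr).
Qed.

Lemma mul_notin_max I r x : r \notin m -> r * x \in I -> x \in I.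
Proof.
move=> /notin_max_unit[s rs] /(ideal_mull s).
by rewrite mulrA (mulrC s) rs mul1r.
Qed.

Lemma max_prime : prime_ideal m.
Proof.
split=> [|u v uv]; first exact: max_proper.
by have [//|/mul_notin_max/(_ uv)] := boolP (u \in m).
Qed.

Lemma zero_prime : prime_ideal (zero_submod R^o).
Proof.
split=> [|u v /in_zero/eqP]; first by apply/negP => /in_zero/eqP; rewrite oner_eq0.
by rewrite mulf_eq0 => /orP[] /eqP h; apply/orP; [left|right]; apply/in_zero.
Qed.

Lemma nonzero_prime_max I x : prime_ideal I -> x \in I -> x != 0 ->
  {subset m <= I}.
Proof.
move=> prI Ix x0; apply: contrapT => nmI.
suff : (2 <= 1)%N by [].
apply: nat_sup_bound R_dim1 _.
exists (fun i => match i with 0 => zero_submod R^o | 1 => I | _ => m end)%N.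
split=> [[|[|i]] _|[|[|i]] //= _]; rewrite ?ltnS //=.
- exact: zero_prime.
- exact: max_prime.
- split=> [y /in_zero ->|h]; first exact: rpred0.
  by have /h/in_zero/eqP := Ix; rewrite (negPf x0).
- by split=> //; apply: proper_sub_max; case: prI.
Qed.

Lemma max_nonzero : exists2 x : R, x \in m & x != 0.
Proof.
have [W [prW ltW]] := nat_sup_mem R_dim1.
have [_ /not_subset[x Wx nWx]] := ltW 0%N isT.
exists x; last by apply: contraNneq nWx => ->; apply: rpred0.
by apply: proper_sub_max Wx; case: (prW 1%N).
Qed.

Lemma submodule_set_colon I b : submodule_set (fun r : R^o => r * b \in I).
Proof.
split=> [|a x y Ix Iy]; first by rewrite mul0r ideal0.
by rewrite mulrDl -[_ *: _]/(a * x) -mulrA ideal_add // ideal_mull.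
Qed.
Definition colon I b := Submodule (submodule_set_colon I b).

Lemma colonP I b r : reflect (r * b \in I) (r \in colon I b).
Proof. exact: (in_SubmoduleP (submodule_set_colon I b)). Qed.

(** A maximal element among the ideals [(I : b)], for [b] outside [I], is prime;
    as it contains the non-zero ideal [I], it is the maximal ideal. *)
Lemma socle_exists I x : x \in I -> x != 0 -> 1 \notin I ->
  exists2 b : R, b \notin I & forall r, r \in m -> r * b \in I.
Proof.
move=> Ix x0 nI1.
suff h (Q : submodClosed R^o) b : b \notin I -> Q =i colon I b ->
    exists2 b : R, b \notin I & forall r, r \in m -> r * b \in I.
  exact: h nI1 (frefl _).
elim/noetherian_ind: Q b => Q IH b nb QE.
have [prQ|nprQ] := pselect (prime_ideal Q).
  exists b => // r mr; apply/colonP; rewrite -QE; apply: (nonzero_prime_max prQ _ x0 mr).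
  by rewrite QE; apply/colonP; apply: ideal_mulr Ix.
have [c [d [cd nc nd]]] : exists c d, [/\ c * d \in Q, c \notin Q & d \notin Q].
  apply: contrapT => h; apply: nprQ; split=> [|c d cd].
    by rewrite QE; apply/colonP; rewrite mul1r; apply/negP.
  apply: contrapT => /negP; rewrite negb_or => /andP[nc nd].
  by apply: h; exists c, d.
apply: (IH (colon I (d * b)) _ (d * b)) => //.
  apply: (@submod_lt_witness _ _ _ _ _ c) => // [r|].
    by rewrite QE => /colonP rb; apply/colonP; rewrite mulrCA ideal_mull.
  by move: cd; rewrite QE => /colonP cdb; apply/colonP; rewrite mulrA.
by move: nd; rewrite QE => /colonP/negP.
Qed.

(** A composition series of [R/I], read from [I] upwards: each step adjoins a
    socle element, so that its factor is the residue field. *)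
Inductive comp_series : submodClosed R^o -> nat -> Prop :=
| CompFull I : 1 \in I -> comp_series I 0
| CompStep I b n : b \notin I -> (forall r, r \in m -> r * b \in I) ->
    comp_series (adjoin I (b : R^o)) n -> comp_series I n.+1.

Lemma comp_series_exists I x : x \in I -> x != 0 -> exists n, comp_series I n.
Proof.
elim/noetherian_ind: I => I IH Ix x0.
have [I1|nI1] := boolP (1 \in I); first by exists 0%N; apply: CompFull.
have [b nb mb] := socle_exists Ix x0 nI1.
have ltI : submod_lt I (adjoin I (b : R^o)).
  by apply: submod_lt_witness (adjoin_id _ _) nb; apply: adjoin_sub.
have [n hn] := IH _ ltI (adjoin_sub _ Ix) x0.
by exists n.+1; apply: CompStep hn.
Qed.

Lemma simple_step I b : b \notin I -> (forall r, r \in m -> r * b \in I) ->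
  length_is I (adjoin I (b : R^o)) 1.
Proof.
move=> nb mb; apply: length_is_step.
  by apply: submod_lt_witness (adjoin_id _ _) nb; apply: adjoin_sub.
move=> U IU [UB nBU] u Uu; apply: contrapT => nIu; apply: nBU.
have /adjoinP[a [r [Ia uE]]] := UB _ Uu.
apply: adjoin_min => //.
have [rm|nrm] := boolP (r \in m).
  by case: nIu; rewrite uE rpredD // mb.
apply: (mul_notin_max nrm); rewrite (_ : r * b = u - a).
  by apply: submodB => //; apply: IU.
by rewrite uE addrAC subrr add0r.
Qed.

Lemma comp_series_length I n : comp_series I n -> length_is I (full_submod R^o) n.
Proof.
elim=> {I n} [I I1|I b n nb mb _ IH].
  by apply: length_is_eq => x _; [apply: in_full|apply: ideal_full].
by rewrite -add1n; apply: length_isD IH; apply: simple_step.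
Qed.

Lemma length_exists I x : x \in I -> x != 0 ->
  exists n, length_is I (full_submod R^o) n.
Proof.
by move=> Ix /(comp_series_exists Ix)[n /comp_series_length]; exists n.
Qed.

Lemma length_exists2 I J x : x \in I -> x != 0 -> {subset I <= J} ->
  exists n, length_is I J n.
Proof.
move=> Ix x0 IJ; have [n [_ hn]] := length_exists Ix x0.
apply: (length_is_exists (N := n.+1)) => // h; apply: hn.
by apply: length_ge_widenr h _ => y _; apply: in_full.
Qed.

Lemma comp_series_exp I n : comp_series I n -> {subset ideal_exp m n <= I}.
Proof.
elim=> {I n} [I I1 x _|I b n nb mb _ IH]; first exact: ideal_full.
apply: span_min => _ [a [v [ma /IH/adjoinP[i [r [Ii ->]]] ->]]].
rewrite scalerDr rpredD //; first exact: rpredZ.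
rewrite -[_ *: (_ *: _)]/(a * (r * b)) mulrCA; apply: ideal_mull; exact: mb.
Qed.

Lemma ideal_exp_pow x n : x \in m -> x ^+ n \in ideal_exp m n.
Proof.
move=> mx; elim: n => [|n IH]; first exact: in_full.
by apply: span_gen; exists x, (x ^+ n); split=> //; rewrite exprS.
Qed.

Lemma pow_in_ideal x I y : x \in m -> y \in I -> y != 0 -> exists n, x ^+ n \in I.
Proof.
move=> mx Iy y0; have [n hn] := comp_series_exists Iy y0.
by exists n; apply: comp_series_exp hn _ (ideal_exp_pow _ mx).
Qed.

Lemma ideal_scaleP r I x :
  reflect (exists2 a : R, a \in I & x = r * a) (x \in sub_scale r I).
Proof. exact: (@sub_scaleP R R^o r I x). Qed.

Lemma submodule_set_scale_preimage (r : R) I : submodule_set (fun x : R^o => r * x \in I).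
Proof.
split=> [|a x y Ix Iy]; first by rewrite mulr0 ideal0.
by rewrite mulrDr -[_ *: _]/(a * x) mulrCA ideal_add // ideal_mull.
Qed.

Lemma length_ge_scale r A B n : r != 0 ->
  length_ge n (sub_scale r A) (sub_scale r B) <-> length_ge n A B.
Proof.
move=> r0; have memE (C : submodClosed R^o) (x : R) : r * x \in sub_scale r C -> x \in C.
  by move=> /ideal_scaleP[c Cc /(mulfI r0)->].
split=> h; last first.
  apply: length_ge_map h => U U' _ _.
    by move=> UU' _ /ideal_scaleP[u Uu ->]; apply/ideal_scaleP; exists u => //; apply: UU'.
  move=> [_ nU'U] h; apply: nU'U => x U'x; apply: memE; apply: h.
  by apply/ideal_scaleP; exists x.
pose F (C : submodClosed R^o) := Submodule (submodule_set_scale_preimage r C).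
have FP (C : submodClosed R^o) (x : R) : reflect (r * x \in C) (x \in F C).
  exact: (in_SubmoduleP (submodule_set_scale_preimage r C)).
have FE (C : submodClosed R^o) : {subset F (sub_scale r C) <= C} by move=> x /FP/memE.
have EF (C : submodClosed R^o) : {subset C <= F (sub_scale r C)}.
  by move=> x Cx; apply/FP/ideal_scaleP; exists x.
apply: length_ge_widenr (FE B); apply: length_ge_widenl (EF A).
apply: length_ge_map h => U U' AU U'B.
  by move=> UU' x /FP/UU' h; apply/FP.
move=> [UU' nU'U] h; apply: nU'U => x U'x.
have /ideal_scaleP[b _ xE] := U'B _ U'x; rewrite xE in U'x *.
by apply/FP; apply: h; apply/FP.
Qed.

Lemma length_is_scale r A B n : r != 0 ->
  length_is A B n -> length_is (sub_scale r A) (sub_scale r B) n.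
Proof. by move=> r0 [h nh]; split; rewrite length_ge_scale. Qed.

Lemma scale_full r : {subset sub_scale r (full_submod R^o) <= line (r : R^o)} /\
  {subset line (r : R^o) <= sub_scale r (full_submod R^o)}.
Proof.
split=> x; first by move=> /ideal_scaleP[a _ ->]; apply/pidealP; exists a.
by move=> /pidealP[a ->]; apply/ideal_scaleP; exists a => //; apply: in_full.
Qed.

Lemma length_is_scale_full r J p n : r != 0 ->
  length_is (line (r : R^o)) (full_submod R^o) p ->
  length_is J (full_submod R^o) n ->
  length_is (sub_scale r J) (full_submod R^o) (n + p).
Proof.
move=> r0 hp hn; have [le ge] := scale_full r.
apply: length_isD (length_is_scale r0 hn) _.
rewrite -[p]add0n; apply: length_isD hp; exact: length_is_eq.
Qed.

Lemma length_principalM a b p q : a != 0 ->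
  length_is (line (a : R^o)) (full_submod R^o) p ->
  length_is (line (b : R^o)) (full_submod R^o) q ->
  length_is (line (a * b : R^o)) (full_submod R^o) (q + p).
Proof.
move=> a0 hp hq; rewrite -[(q + p)%N]add0n; apply: length_isD (length_is_scale_full a0 hp hq).
apply: length_is_eq => x.
  move=> /pidealP[r ->]; apply/ideal_scaleP; exists (b * r); last by rewrite mulrA.
  by apply/pidealP; exists r.
move=> /ideal_scaleP[_ /pidealP[r ->] ->]; apply/pidealP; exists r; exact: mulrA.
Qed.

Lemma length_max_pos x n : x \in m -> length_is (line (x : R^o)) (full_submod R^o) n ->
  (0 < n)%N.
Proof.
move=> mx hn; apply: (length_is_lt0 hn).
apply: (@submod_lt_witness _ _ _ _ _ 1); [by move=> *; apply: in_full|exact: in_full|].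
by apply: contra max_proper; apply: pideal_min.
Qed.

End LocalRing.

(*CUT*)

(** * Integral fractions *)

Section Integrality.
Variable R : idomainType.
Local Notation K := {fraction R}.
Local Notation "x %:F" := (@tofrac R x).
Local Notation Rbar := (@integral_closure R).
Implicit Types (x y r s : R) (a b : K).

Lemma tofrac_inj : injective (@tofrac R).
Proof. by move=> x y /eqP; rewrite tofrac_eq => /eqP. Qed.

Lemma frac_repr a : exists n d : R, d != 0 /\ a = n%:F / d%:F.
Proof.
elim/quotW: a => -[[n d] /= d0]; exists n, d; split=> //.
have dF : d%:F != 0 by rewrite tofrac_eq0.
apply: (mulIf dF); rewrite divfK //; unlock tofrac.
rewrite -[LHS]FracField.pi_mul; apply/eqmodP.
rewrite /= FracField.equivfE /FracField.mulf /=.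
by rewrite !numden_Ratio /= ?mulf_neq0 ?oner_eq0 // !mulr1 mulrC.
Qed.

Lemma integral_closure_frac x : Rbar x%:F.
Proof. exact: integral_id. Qed.

Lemma integral_closureM a b : Rbar a -> Rbar b -> Rbar (a * b).
Proof. exact: integral_mul. Qed.

Lemma integral_closureD a b : Rbar a -> Rbar b -> Rbar (a + b).
Proof. exact: integral_add. Qed.

(** Clearing denominators in the equation of [r/y], every term but the first
    acquires a factor [y]. *)
Lemma monic_root_pow (p : {poly R}) n r y : p \is monic -> size p = n.+1 ->
  y != 0 -> root (map_poly (@tofrac R) p) (r%:F / y%:F) -> r ^+ n \in line (y : R^o).
Proof.
move=> pm sp y0 /rootP; rewrite (horner_coef_wide (n := n.+1)); last first.
  by rewrite size_map_inj_poly ?rmorph0 ?sp //; apply: tofrac_inj.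
have yF : y%:F != 0 by rewrite tofrac_eq0.
move=> /(congr1 (fun z => z * y%:F ^+ n)); rewrite mul0r mulr_suml => h.
have : \sum_(i < n.+1) p`_i * r ^+ i * y ^+ (n - i) = 0.
  apply: tofrac_inj; rewrite rmorph0 -h rmorph_sum; apply: eq_bigr => i _.
  rewrite coef_map !rmorphM !rmorphXn exprMn -!mulrA; congr (_ * (_ * _)).
  have -> : y%:F ^+ n = y%:F ^+ (n - i) * y%:F ^+ i by rewrite -exprD subnK // -ltnS.
  by rewrite mulrCA -exprMn mulVf // expr1n mulr1.
rewrite big_ord_recr /= subnn mulr1; have -> : p`_n = 1.
  by move/monicP: pm; rewrite lead_coefE sp.
rewrite mul1r addrC => /eqP; rewrite addr_eq0 => /eqP ->.
apply/pidealP; exists (- \sum_(i < n) p`_i * r ^+ i * y ^+ (n - i).-1).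
rewrite mulrN mulr_sumr; congr (- _); apply: eq_bigr => i _.
by rewrite mulrCA -exprS prednK // subn_gt0.
Qed.

(** The fraction [r/y] maps the ideal generated by the [b i] into itself, so it is
    an eigenvalue of a matrix over [R], whose size is the number of generators,
    and a root of the characteristic polynomial. *)
Lemma determinant_trick n (b : nat -> R) r y : b 0%N != 0 -> y != 0 ->
  (forall i, (i < n.+1)%N -> exists c : nat -> R,
     r * b i = y * \sum_(j < n.+1) c j * b j) ->
  r ^+ n.+1 \in line (y : R^o).
Proof.
move=> b0 y0 hb.
have /choice[c hc] : forall i : 'I_n.+1, exists c : nat -> R,
     r * b i = y * \sum_(j < n.+1) c j * b j by move=> i; apply: hb.
pose A : 'M[R]_n.+1 := \matrix_(j, i) c i j.
apply: (@monic_root_pow (char_poly A)) => //; rewrite ?char_poly_monic ?size_char_poly //.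
rewrite map_char_poly -eigenvalue_root_char; apply/eigenvalueP.
exists (\row_j (b j)%:F); last first.
  by apply/eqP => /matrixP/(_ ord0 ord0); rewrite !mxE /= => /eqP; rewrite tofrac_eq0 (negPf b0).
have yF : y%:F != 0 by rewrite tofrac_eq0.
apply/matrixP => i0 i; rewrite !mxE; apply: (mulfI yF).
rewrite mulrA mulrCA divff // mulr1 -rmorphM hc rmorphM; congr (_ * _).
rewrite rmorph_sum; apply: eq_bigr => j _.
by rewrite !mxE -rmorphM mulrC.
Qed.

Lemma clear_denominators (q : {poly R}) r y d : y != 0 -> (size q <= d.+1)%N ->
  exists s, s%:F = y%:F ^+ d * (map_poly (@tofrac R) q).[r%:F / y%:F].
Proof.
move=> y0 sq; exists (\sum_(i < d.+1) q`_i * r ^+ i * y ^+ (d - i)).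
rewrite (horner_coef_wide (n := d.+1)); last first.
  by rewrite size_map_inj_poly ?rmorph0 //; apply: tofrac_inj.
have yF : y%:F != 0 by rewrite tofrac_eq0.
rewrite rmorph_sum mulr_sumr; apply: eq_bigr => i _.
rewrite coef_map !rmorphM !rmorphXn exprMn mulrCA -!mulrA; congr (_ * _).
rewrite mulrCA; congr (_ * _).
have -> : y%:F ^+ d = y%:F ^+ (d - i) * y%:F ^+ i by rewrite -exprD subnK // -ltnS.
by rewrite -mulrA -exprMn divff // expr1n mulr1.
Qed.

(** The ideal is [y^d R[r/y]], where [d] is large enough for the remainders
    modulo an integral equation of [r/y] to have their denominators cleared. *)
Lemma integral_stable_ideal r y : y != 0 -> Rbar (r%:F / y%:F) ->
  exists I : submodClosed R^o, (exists2 x : R, x \in I & x != 0) /\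
    forall s, s \in I -> exists2 t : R, t \in I & r * s = y * t.
Proof.
move=> y0 [p pm rp]; pose d := (size p).
have yF : y%:F != 0 by rewrite tofrac_eq0.
have IP : submodule_set (fun s : R^o => exists q : {poly R},
    (s : R)%:F = y%:F ^+ d * (map_poly (@tofrac R) q).[r%:F / y%:F]).
  split=> [|a u v [q hq] [q' hq']].
    by exists 0; rewrite [LHS]rmorph0 map_poly0 horner0 mulr0.
  exists (a *: q + q'); rewrite [LHS](rmorphD (@tofrac R) (a * u) v) rmorphM /= hq hq'.
  rewrite [map_poly _ (_ + _)]rmorphD hornerD mulrDr; congr (_ + _).
  by rewrite /= map_polyZ hornerZ mulrCA.
exists (Submodule IP); split.
  exists (y ^+ d); last by rewrite expf_neq0.
  by apply/(in_SubmoduleP IP); exists 1; rewrite rmorph1 hornerC mulr1 rmorphXn.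
move=> s /(in_SubmoduleP IP)[q hq].
have [t ht] : exists t, t%:F = y%:F ^+ d * (map_poly (@tofrac R) (q * 'X)).[r%:F / y%:F].
  rewrite (Pdiv.RingMonic.rdivp_eq pm (q * 'X)) rmorphD rmorphM hornerD hornerM.
  rewrite (rootP rp) mulr0 add0r; apply: clear_denominators => //.
  rewrite ltnW // ltnS ltnW //; apply: Pdiv.Ring.ltn_rmodpN0.
  exact: monic_neq0.
exists t; first by apply/(in_SubmoduleP IP); exists (q * 'X).
apply: tofrac_inj; rewrite !tofracM ht hq rmorphM hornerM /= map_polyX hornerX mulrCA.
rewrite (mulrCA y%:F); congr (_ * _).
by rewrite mulrCA (mulrCA y%:F) divff // mulr1 mulrC.
Qed.

End Integrality.

Section GeneratorBound.
Variables (R : idomainType) (m : submodClosed R^o).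
Hypothesis R_noetherian : noetherian R.
Hypothesis R_local : local_ring m.
Hypothesis R_dim1 : krull_dim R = 1%:E.
Local Notation "x %:F" := (@tofrac R x).
Local Notation Rbar := (@integral_closure R).
Implicit Types (I J A B : submodClosed R^o) (x y r s : R).

Lemma submodule_set_gens (b : nat -> R) n :
  submodule_set (fun u : R^o => exists c : nat -> R, (u : R) = \sum_(i < n) c i * b i).
Proof.
split=> [|a u v [c ->] [c' ->]].
  by exists (fun=> 0); rewrite big1 // => i _; rewrite mul0r.
exists (fun i => a * c i + c' i); rewrite -[_ *: _]/(a * _) mulr_sumr -big_split.
by apply: eq_bigr => i _; rewrite /= mulrDl mulrA.
Qed.
Definition gens b n := Submodule (submodule_set_gens b n).

Lemma gensP (b : nat -> R) n (u : R) :
  reflect (exists c : nat -> R, u = \sum_(i < n) c i * b i) (u \in gens b n).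
Proof. exact: (in_SubmoduleP (submodule_set_gens b n)). Qed.

Lemma gens_mem (b : nat -> R) n i : (i < n)%N -> b i \in gens b n.
Proof.
move=> i_n; apply/gensP; exists (fun j => (j == i)%:R).
rewrite (bigD1 (Ordinal i_n)) //= eqxx mul1r big1 ?addr0 // => j.
by rewrite -val_eqE /= => /negPf ->; rewrite mul0r.
Qed.

Lemma gens_min (b : nat -> R) n I : (forall i, (i < n)%N -> b i \in I) -> {subset gens b n <= I}.
Proof.
move=> bI u /gensP[c ->]; elim/big_ind: _ => [|v w|i _]; first exact: ideal0.
  exact: ideal_add.
by apply: ideal_mull; apply: bI.
Qed.

(** The quotients [I/xI] and [R/xR] have the same length [e], so [e] elements
    generate [I] modulo [xI]. One more non-zero generator makes Nakayama's lemma
    elementary: the same elements generate [I] modulo every [x^j I], and some [x^j]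
    is a multiple of this generator. *)
Lemma generator_bound x e I x0 : x \in m -> x != 0 ->
  length_is (line (x : R^o)) (full_submod R^o) e -> x0 \in I -> x0 != 0 ->
  exists b : nat -> R, [/\ b 0%N != 0, forall i, b i \in I & {subset I <= gens b e.+2}].
Proof.
move=> mx xn0 he Ix0 x0n0; pose xI := sub_scale (x : R) I.
have xIn0 : x * x0 \in xI by apply/ideal_scaleP; exists x0.
have xx0 : x * x0 != 0 by rewrite mulf_neq0.
have [e' he'] := length_exists2 R_noetherian R_local R_dim1 xIn0 xx0 (@sub_scale_sub _ _ x I).
have [l hl] := length_exists R_noetherian R_local R_dim1 Ix0 x0n0.
have ee' : e' = e.
  have := length_is_uniq (length_isD he' hl) (length_is_scale_full xn0 he hl).
  lia.
rewrite {}ee' in he'.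
have step k : exists b : nat -> R, [/\ b 0%N != 0, forall i, b i \in I &
    {subset I <= sub_add xI (gens b k.+1)} \/ length_ge k xI (sub_add xI (gens b k.+1))].
  elim: k => [|k [b [b0 bI hb]]].
    by exists (fun=> x0); split=> //; right; apply: sub_addl.
  have gS : {subset gens b k.+1 <= gens b k.+2}.
    by apply: gens_min => i ik; apply: gens_mem; apply: ltnW.
  have gS' : {subset sub_add xI (gens b k.+1) <= sub_add xI (gens b k.+2)}.
    by apply: sub_add_min => [u|u /gS]; [apply: sub_addl|apply: sub_addr].
  have [h|h] := pselect ({subset I <= sub_add xI (gens b k.+1)}).
    by exists b; split=> //; left=> u /h/gS'.
  case: hb => // hb; have [u Iu nu] := not_subset h.
  pose b' i := if i == k.+1 then u else b i.
  exists b'; split=> // [i|]; first by rewrite /b'; case: eqP.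
  have gb : {subset gens b k.+1 <= gens b' k.+2}.
    apply: gens_min => i ik; have -> : b i = b' i by rewrite /b' ltn_eqF.
    by apply: gens_mem; apply: ltnW.
  right; exists (sub_add xI (gens b k.+1)) => //.
  apply: submod_lt_witness (u) _ nu.
    by apply: sub_add_min => [v|v /gb]; [apply: sub_addl|apply: sub_addr].
  apply: sub_addr; have -> : u = b' k.+1 by rewrite /b' eqxx.
  exact: gens_mem.
(* A chain of [e + 1] strict steps does not fit between [xI] and [I]. *)
have [b [b0 bI hb]] := step e.+1.
exists b; split=> //.
have gI : {subset gens b e.+2 <= I} by apply: gens_min => i _.
have hb' : {subset I <= sub_add xI (gens b e.+2)}.
  case: hb => // hb; case: (he') => _; case; apply: length_ge_widenr hb _.
  by apply: sub_add_min => //; apply: sub_scale_sub.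
have iter j (u : R) : u \in I ->
    exists v g : R, [/\ v \in I, g \in gens b e.+2 & u = x ^+ j * v + g].
  elim: j u => [|j IH] u Iu.
    by exists u, 0; split; rewrite ?ideal0 // mul1r addr0.
  have [v [g [Iv gg ->]]] := IH _ Iu.
  have /sub_addP[_ [g' [/ideal_scaleP[w Iw ->] gg' ->]]] := hb' _ Iv.
  exists w, (x ^+ j * g' + g); split=> //; first by apply: ideal_add => //; apply: ideal_mull.
  transitivity (x ^+ j * ((x * w : R) + g') + g : R) => //.
  by rewrite mulrDr exprSr !mulrA addrA.
have b0g : b 0%N \in gens b e.+2 by apply: gens_mem.
have [j hj] := pow_in_ideal R_noetherian R_local R_dim1 mx b0g b0.
move=> u /(iter j)[v [g [Iv gg ->]]].
by apply: ideal_add => //; apply: (ideal_mulr v hj).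
Qed.

(** The point is the uniformity: the exponent depends neither on the fraction
    [r/y] nor on the degree of an integral equation for it. *)
Lemma integral_pow_bound x e r y : x \in m -> x != 0 ->
  length_is (line (x : R^o)) (full_submod R^o) e ->
  y != 0 -> Rbar (r%:F / y%:F) -> r ^+ e.+2 \in line (y : R^o).
Proof.
move=> mx xn0 he y0 /(integral_stable_ideal y0)[I [[x0 Ix0 x0n0] hI]].
have [b [b0 bI Ib]] := generator_bound mx xn0 he Ix0 x0n0.
apply: determinant_trick b0 y0 _ => i _.
by have [t /Ib/gensP[c ->] ->] := hI _ (bI i); exists c.
Qed.

End GeneratorBound.

(*CUT*)

(** * The conductor is non-zero *)

Section ConductorNonzero.
Variables (R : idomainType) (m : submodClosed R^o).
Hypothesis R_noetherian : noetherian R.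
Hypothesis R_local : local_ring m.
Hypothesis R_dim1 : krull_dim R = 1%:E.
Local Notation "x %:F" := (@tofrac R x).
Local Notation Rbar := (@integral_closure R).
Implicit Types (I J A B : submodClosed R^o) (x y r s : R).

Lemma conductorP c : reflect (forall b, Rbar b -> exists s, s%:F = c%:F * b)
  (c \in conductor R).
Proof.
apply: (iffP (in_SubmoduleP (@submodule_set_conductor R) c)) => h b /h.
  by case=> s _ sE; exists s.
by case=> s sE; exists s.
Qed.

Lemma descending_chain (W : nat -> submodClosed R^o) B x : x \in B -> x != 0 ->
  (forall i, {subset B <= W i}) -> (forall i, {subset W i.+1 <= W i}) ->
  exists N, forall n, {subset W N <= W n}.
Proof.
move=> Bx x0 BW WS; have W_le i j : (i <= j)%N -> {subset W j <= W i}.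
  elim: j => [|j IH]; first by rewrite leqn0 => /eqP->.
  by rewrite leq_eqVlt => /orP[/eqP->//|/IH h y /WS]; apply: h.
apply: contrapT => nst.
have long k : exists N, length_ge k (W N) (full_submod R^o).
  elim: k => [|k [N hN]]; first by exists 0%N => y _; apply: in_full.
  have [n nWn] : exists n, ~ {subset W N <= W n}.
    by apply: contrapT => h; apply: nst; exists N => n; apply: contrapT => h'; apply: h; exists n.
  have Nn : (N <= n)%N.
    by rewrite leqNgt; apply/negP => /ltnW nN; apply: nWn; apply: W_le.
  exists n; rewrite -add1n; apply: length_geD hN.
  by exists (W n) => //; split=> //; apply: W_le.
have [l [_ hl]] := length_exists R_noetherian R_local R_dim1 Bx x0.
have [N hN] := long l.+1; apply: hl; exact: length_ge_widenl hN (BW N).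
Qed.

Variable x : R.
Hypotheses (mx : x \in m) (x0 : x != 0).

Let xF : x%:F != 0. Proof. by rewrite tofrac_eq0. Qed.

Lemma submodule_set_integral_power n :
  submodule_set (fun r : R^o => Rbar ((r : R)%:F / x%:F ^+ n)).
Proof.
split=> [|a r s hr hs]; first by rewrite [_%:F]rmorph0 mul0r; apply: integral0.
have -> : (a *: r + s : R^o)%:F = a%:F * (r : R)%:F + (s : R)%:F.
  by rewrite -tofracM -tofracD.
rewrite mulrDl -mulrA.
apply: integral_closureD; last exact: hs.
by apply: integral_closureM; [apply: integral_closure_frac|apply: hr].
Qed.

(** The integral closure of the ideal [x^n R]. *)
Definition integral_power n := Submodule (submodule_set_integral_power n).

Lemma integral_powerP n r :
  reflect (Rbar (r%:F / x%:F ^+ n)) (r \in integral_power n).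
Proof. exact: (in_SubmoduleP (submodule_set_integral_power n)). Qed.

Lemma integral_powerS n : {subset integral_power n.+1 <= integral_power n}.
Proof.
move=> r /integral_powerP hr; apply/integral_powerP.
have -> : r%:F / x%:F ^+ n = x%:F * (r%:F / x%:F ^+ n.+1).
  have aux (F : fieldType) (a b : F) : b != 0 -> a / b ^+ n = b * (a / b ^+ n.+1).
    by move=> b0; rewrite exprS; field; rewrite expf_neq0 ?b0.
  exact: aux.
by apply: integral_closureM; [apply: integral_closure_frac|apply: hr].
Qed.

Lemma integral_power_le n k : (n <= k)%N -> {subset integral_power k <= integral_power n}.
Proof.
elim: k => [|k IH]; first by rewrite leqn0 => /eqP->.
by rewrite leq_eqVlt => /orP[/eqP->//|/IH h r /integral_powerS/h].
Qed.

(** The inclusion forces [integral_power (n + k) = x^k integral_power n] for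
    every [k]. As every fraction has a power of [x] as a denominator, [x^n]
    multiplies each integral fraction into [R]. *)
Lemma integral_power_conductor n :
  {subset integral_power n <= line (x : R^o)} -> x ^+ n \in conductor R.
Proof.
move=> hn; have stable k a : a \in integral_power (n + k) ->
    exists2 a', a' \in integral_power n & a = x ^+ k * a'.
  elim: k a => [|k IH] a; first by rewrite addn0 => ha; exists a; rewrite ?mul1r.
  move=> ha; have /hn/pidealP[a1 aE] := integral_power_le (leq_addr _ _) ha.
  have [|a' ha' a1E] := IH a1; last by exists a'; rewrite // exprS -mulrA -a1E.
  move/integral_powerP: ha => ha; apply/integral_powerP; move: ha.
  congr (integral_closure _); rewrite aE tofracM addnS exprS.
  by rewrite -mulf_div divff // mul1r.
apply/conductorP => b hb; have [a [d [d0 bE]]] := frac_repr b.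
have dF : d%:F != 0 by rewrite tofrac_eq0.
have [k /pidealP[t xk]] := pow_in_ideal R_noetherian R_local R_dim1 mx (line_id (d : R^o)) d0.
have tF : t%:F != 0.
  by rewrite tofrac_eq0; apply: contraTneq (expf_neq0 k x0) => t0; rewrite xk t0 mulr0 eqxx.
have xkF : x%:F ^+ k = d%:F * t%:F by rewrite -tofracXn xk tofracM.
have [|a' _ aE] := stable k (a * t * x ^+ n).
  apply/integral_powerP; move: hb; congr (integral_closure _).
  rewrite bE !tofracM tofracXn exprD xkF.
  have aux (F : fieldType) (u v w z : F) : v != 0 -> w != 0 -> z != 0 ->
      u / v = u * w * z / (z * (v * w)).
    by move=> v0 w0 z0; field; rewrite v0 w0.
  exact: (aux _ _ _ _ _ dF tF (expf_neq0 n xF)).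
exists a'; apply: (mulfI (expf_neq0 k xF)).
rewrite -tofracXn -tofracM -aE bE !tofracM !tofracXn xkF.
have aux (F : fieldType) (u v w t' : F) : v != 0 -> u * t' * w = v * t' * (w * (u / v)).
  by move=> v0; field.
exact: aux.
Qed.

Lemma proj_ring_eq0 I r : proj_ring I r = 0 <-> r \in I.
Proof.
by rewrite -[0 in X in X <-> _](proj_quot0 I) proj_quot_eq subr0.
Qed.

Lemma proj_ringX I r n : proj_ring I (r ^+ n) = proj_ring I r ^+ n.
Proof. by elim: n => [//|n IH]; rewrite !exprS proj_ringM IH. Qed.

Lemma adic_prodX (f : adic_prod m) n k : (f ^+ n) k = f k ^+ n.
Proof. by elim: n => [//|n IH]; rewrite !exprS -IH. Qed.

Lemma ideal_exp_decr n : {subset ideal_exp m n.+1 <= ideal_exp m n}.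
Proof. by apply: span_min => _ [a [v [_ mv ->]]]; apply: rpredZ. Qed.

(** Chevalley's argument: as [R/x^k R] has finite length for each [k], one finds
    a compatible sequence of elements outside [xR] whose [k]-th term lies in
    [integral_power k.+1] up to a multiple of [x^(k+1)]. It defines a non-zero
    element of the completion, which is nilpotent because the exponent in
    [integral_pow_bound] is uniform. *)
Lemma nilpotent_in_completion :
  (forall n, ~ {subset integral_power n <= line (x : R^o)}) ->
  exists2 z : completion m, z != 0 & exists n, z ^+ n = 0.
Proof.
move=> hA; pose xk k := line (x ^+ k : R^o).
have xkS k : {subset xk k.+1 <= xk k}.
  by apply: pideal_min; apply/pidealP; exists x; rewrite exprSr.
pose D k n := sub_add (integral_power n) (xk k).
have /choice[N hN] : forall k, exists N, forall n, {subset D k N <= D k n}.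
  move=> k; apply: (@descending_chain (D k) (xk k) (x ^+ k)).
  - exact: line_id.
  - exact: expf_neq0.
  - by move=> n; apply: sub_addr.
  - move=> n; apply: sub_add_min => [r /integral_powerS|r]; first exact: sub_addl.
    exact: sub_addr.
have next k (u : {u : R | u \in D k (N k)}) :
    {v : {v : R | v \in D k.+1 (N k.+1)} | sval v - sval u \in xk k}.
  apply: cid; case: u => u /= /(hN k (N k.+1))/sub_addP[a [b [Aa xb uE]]].
  exists (exist _ a (sub_addl (xk k.+1) Aa)) => /=.
  by rewrite uE opprD addrA subrr sub0r; apply: (ideal_opp xb).
have [a0 A0 na0] := not_subset (hA (N 1%N)).
pose s' := fix s' k : {u : R | u \in D k.+1 (N k.+1)} :=
  if k is k'.+1 then sval (next k'.+1 (s' k')) else exist _ a0 (sub_addl (xk 1%N) A0).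
pose s k := sval (s' k).
have sS k : s k.+1 - s k \in xk k.+1 by rewrite /s /=; case: (next _ _).
have xk_le k : {subset xk k.+1 <= line (x : R^o)}.
  by apply: pideal_min; apply/pidealP; exists (x ^+ k); rewrite exprS.
have ns k : s k \notin line (x : R^o).
  elim: k => [//|k]; apply: contra => hs.
  have -> : s k = s k.+1 - (s k.+1 - s k) by rewrite opprB addrC subrK.
  by apply: ideal_sub => //; apply: xk_le (sS k).
have [e he] := length_exists R_noetherian R_local R_dim1 (line_id (x : R^o)) x0.
have spow k : s k ^+ e.+2 \in xk k.+1.
  have /(hN k.+1 k.+1)/sub_addP[a [b [/integral_powerP Aa /pidealP[t ->] sE]]] := proj2_sig (s' k).
  have xk0 : x ^+ k.+1 != 0 by apply: expf_neq0.
  have : a ^+ e.+2 \in xk k.+1.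
    apply: (integral_pow_bound R_noetherian R_local R_dim1 mx x0 he xk0).
    by rewrite tofracXn; exact: Aa.
  have -> : s k = (a : R) + x ^+ k.+1 * t := sE.
  move=> ha; rewrite -[_ ^+ _](subrK ((a : R) ^+ e.+2)); apply: ideal_add => //.
  rewrite subrXX addrAC subrr add0r -mulrA; apply/pidealP; eexists; reflexivity.
have xkm k : {subset xk k.+1 <= ideal_exp m k}.
  apply: pideal_min; apply: ideal_exp_decr; exact: ideal_exp_pow.
pose z : adic_prod m := fun k => proj_ring (ideal_exp m k) (s k).
have zP : z \in adic_coherent (I := m).
  apply/asboolP => k; exists (s k.+1); split=> //.
  apply/esym/proj_quot_eq; exact: xkm (sS k).
exists (exist _ z zP : completion m).
  apply/eqP => /(congr1 (fun w : completion m => \val w)) /= hz.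
  have [n hn] := comp_series_exists R_noetherian R_local R_dim1 (line_id (x : R^o)) x0.
  have /proj_ring_eq0 : z n = 0 by rewrite hz.
  by move/(comp_series_exp hn); apply/negP.
exists e.+2; apply: val_inj; rewrite rmorphXn /=.
apply: functional_extensionality_dep => k; rewrite adic_prodX -proj_ringX.
by apply/proj_ring_eq0; apply: xkm (spow k).
Qed.

End ConductorNonzero.

(** This is the finiteness of the integral closure of an analytically unramified
    ring, for a domain of dimension one. *)
Lemma conductor_nonzero (R : idomainType) (m : submodClosed R^o) :
  noetherian R -> local_ring m -> krull_dim R = 1%:E -> reduced (completion m) ->
  exists2 c : R, c \in conductor R & c != 0.
Proof.
move=> noeth loc dim1 red; have [x mx x0] := max_nonzero noeth loc dim1.
have [[n hn]|h] := pselect (exists n, {subset integral_power x n <= line (x : R^o)}).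
  exists (x ^+ n); last exact: expf_neq0.
  exact: (integral_power_conductor noeth loc dim1 mx x0 hn).
have [|z z0 [n /red zn]] := nilpotent_in_completion noeth loc dim1 mx x0.
  by move=> n hn; apply: h; exists n.
by rewrite zn eqxx in z0.
Qed.

(** * The invariant [h] of an ideal in terms of the valuation *)

Section Valuation.
Variable R : idomainType.
Local Notation "x %:F" := (@tofrac R x).
Local Notation Rbar := (@integral_closure R).
Hypothesis Rbar_dvr : is_dvr Rbar.
Implicit Types (c d : R).

Lemma dvr_total a : a != 0 -> Rbar a \/ Rbar a^-1.
Proof.
have [v [_ vM _ vP]] := Rbar_dvr => a0.
have v1 : v 1 = 0 by have := vM 1 1 (oner_neq0 _) (oner_neq0 _); rewrite mulr1; lia.
have := vM a a^-1 a0; rewrite invr_eq0 divff // v1 => /(_ a0) h.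
by have [va|va] := lerP 0 (v a); [left|right]; apply/vP; right; lia.
Qed.

(** An element of [K] which maps the conductor into itself is integral, since
    the values of its powers cannot become arbitrarily negative. *)
Lemma conductor_stabilizer a (c : R) : c \in conductor R -> c != 0 -> a != 0 ->
  (forall d : R, d \in conductor R -> exists2 d' : R, d' \in conductor R & d'%:F = d%:F * a) ->
  Rbar a.
Proof.
move=> hc c0 a0 ha; have [v [_ vM _ vP]] := Rbar_dvr.
have cF : c%:F != 0 by rewrite tofrac_eq0.
have pow n : exists2 d : R, d \in conductor R & d%:F = c%:F * a ^+ n.
  elim: n => [|n [d hd dE]]; first by exists c; rewrite ?mulr1.
  by have [d' hd' dE'] := ha _ hd; exists d' => //; rewrite dE' dE exprSr mulrA.
have vpow n : v (c%:F * a ^+ n) = v c%:F + v a *+ n.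
  elim: n => [|n IH]; first by rewrite mulr1 mulr0n addr0.
  by rewrite exprSr mulrA vM ?mulf_neq0 ?expf_neq0 // IH mulrSr addrA.
apply/vP; right; rewrite leNgt; apply/negP => va.
have := pow `|v c%:F|.+1; set n := _.+1 => -[d _ dE].
have : Rbar (c%:F * a ^+ n) by rewrite -dE; apply: integral_closure_frac.
move=> /vP[/eqP|]; first by rewrite mulf_eq0 (negPf cF) expf_eq0 (negPf a0) andbF.
by rewrite vpow /n; nia.
Qed.

Lemma conductorM (c : R) a : c \in conductor R -> Rbar a ->
  exists2 d : R, d \in conductor R & d%:F = c%:F * a.
Proof.
move=> /conductorP hc ha; have [d dE] := hc _ ha; exists d => //.
apply/conductorP => b hb; have [s sE] := hc _ (integral_closureM ha hb).
by exists s; rewrite sE dE mulrA.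
Qed.

End Valuation.

Section LengthComparison.
Variables (R : idomainType) (m : submodClosed R^o).
Hypothesis R_noetherian : noetherian R.
Hypothesis R_local : local_ring m.
Hypothesis R_dim1 : krull_dim R = 1%:E.
Local Notation "x %:F" := (@tofrac R x).
Local Notation Rbar := (@integral_closure R).
Hypothesis Rbar_dvr : is_dvr Rbar.
Variable c0 : R.
Hypotheses (c0_conductor : c0 \in conductor R) (c0_neq0 : c0 != 0).
Implicit Types (I J A B : submodClosed R^o) (x y r s : R).
Local Notation full := (full_submod R^o).

Let cF : c0%:F != 0. Proof. by rewrite tofrac_eq0. Qed.

Lemma submodule_set_closure_multiple :
  submodule_set (fun r : R^o => Rbar ((r : R)%:F / c0%:F)).
Proof.
split=> [|a r s hr hs]; first by rewrite [_%:F]rmorph0 mul0r; apply: integral0.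
have -> : (a *: r + s : R^o)%:F = a%:F * (r : R)%:F + (s : R)%:F.
  by rewrite -tofracM -tofracD.
rewrite mulrDl -mulrA.
apply: integral_closureD; last exact: hs.
by apply: integral_closureM; [apply: integral_closure_frac|apply: hr].
Qed.

(** The ideal [c0 Rbar], contained in [R] because [c0] is in the conductor. *)
Definition closure_multiple := Submodule submodule_set_closure_multiple.

Lemma closure_multipleP r :
  reflect (Rbar (r%:F / c0%:F)) (r \in closure_multiple).
Proof. exact: (in_SubmoduleP submodule_set_closure_multiple). Qed.

Lemma closure_multiple_id : c0 \in closure_multiple.
Proof. apply/closure_multipleP; rewrite divff; last exact: cF. exact: integral1. Qed.

Lemma scale_closure_multiple a b : a != 0 -> b != 0 -> Rbar (a%:F / b%:F) ->
  {subset sub_scale a closure_multiple <= sub_scale b closure_multiple}.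
Proof.
move=> a0 b0 hab _ /ideal_scaleP[s /closure_multipleP hs ->].
have bF : b%:F != 0 by rewrite tofrac_eq0.
have [t tE] := conductorP _ c0_conductor _ (integral_closureM hab hs).
apply/ideal_scaleP; exists t.
  have E : t%:F / c0%:F = a%:F / b%:F * (s%:F / c0%:F) by rewrite tE mulrAC divff ?mul1r.
  apply/closure_multipleP; rewrite E; exact: integral_closureM hab hs.
apply: (@tofrac_inj R); rewrite !tofracM tE.
have aux (F : fieldType) (u v w z : F) : v != 0 -> z != 0 ->
    u * w = v * (z * (u / v * (w / z))).
  by move=> ? ?; field; apply/andP.
exact: aux.
Qed.

(** Lengths of principal quotients are compared through the ideals
    [a c0 Rbar], which are totally ordered by inclusion. *)
Lemma length_principal_le a b p q : a != 0 -> b != 0 ->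
  length_is (line (a : R^o)) full p -> length_is (line (b : R^o)) full q ->
  Rbar (a%:F / b%:F) -> (q <= p)%N.
Proof.
move=> a0 b0 hp hq hab.
have [l hl] := length_exists R_noetherian R_local R_dim1 closure_multiple_id c0_neq0.
have ha := length_is_scale_full a0 hp hl; have hb := length_is_scale_full b0 hq hl.
rewrite -(leq_add2l l); apply/(length_isP ha).
by apply: length_ge_widenl (proj1 hb) _; apply: scale_closure_multiple.
Qed.

Lemma length_principal_lt a b p q : a != 0 -> b != 0 ->
  length_is (line (a : R^o)) full p -> length_is (line (b : R^o)) full q ->
  ~ Rbar (a%:F / b%:F) -> (p < q)%N.
Proof.
move=> a0 b0 hp hq hab.
have aF : a%:F != 0 by rewrite tofrac_eq0.
have bF : b%:F != 0 by rewrite tofrac_eq0.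
have hba : Rbar (b%:F / a%:F).
  have ab0 : a%:F / b%:F != 0 by rewrite mulf_neq0 ?invr_eq0.
  have [h|h] := dvr_total Rbar_dvr ab0; first by case: (hab h).
  by rewrite -invf_div; exact: h.
have [l hl] := length_exists R_noetherian R_local R_dim1 closure_multiple_id c0_neq0.
have ha := length_is_scale_full a0 hp hl; have hb := length_is_scale_full b0 hq hl.
suff h : (1 + (l + p) <= l + q)%N by move: h; clear; lia.
apply/(length_isP hb); apply: length_geD (proj1 ha).
exists (sub_scale (b : R) closure_multiple); first by [].
apply: (@submod_lt_witness _ _ _ _ _ (a * c0)).
- exact: scale_closure_multiple.
- by apply/ideal_scaleP; exists c0; first exact: closure_multiple_id.
apply/negP => /ideal_scaleP[s /closure_multipleP hs E]; apply: hab.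
move: hs; congr (integral_closure _).
have : (a * c0)%:F = (b * s)%:F by rewrite [(a * c0 : R)]E.
rewrite !tofracM => E'; apply: (mulfI bF); rewrite mulrA -E' mulfK //.
by rewrite mulrCA divff // mulr1.
Qed.

Lemma length_isomorphic_ideals a b I J n n' p q : a != 0 -> b != 0 ->
  (forall x, x \in sub_scale a J <-> x \in sub_scale b I) ->
  length_is J full n -> length_is I full n' ->
  length_is (line (a : R^o)) full p -> length_is (line (b : R^o)) full q ->
  (n + p = n' + q)%N.
Proof.
move=> a0 b0 E hJ hI hp hq.
have ha := length_is_scale_full a0 hp hJ; have hb := length_is_scale_full b0 hq hI.
have e : length_is (sub_scale a J) (sub_scale b I) 0.
  by apply: length_is_eq => x /E.
by have := length_is_uniq (length_isD e hb) ha; clear; lia.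
Qed.

(** Every non-zero homomorphism from [J] to [R] is multiplication by a fraction
    [a/b], and it changes the colength by the difference of the lengths of [R/a]
    and [R/b]. Hence [J] has minimal colength in its isomorphism class if and only
    if each fraction multiplying [J] into [R] has non-negative value. *)
Lemma h_invE J x0 : x0 \in J -> x0 != 0 ->
  (h_inv (submod_of J) = mod_length (quot_mod J) <->
   forall a b : R, a != 0 -> b != 0 -> {subset sub_scale a J <= line (b : R^o)} ->
     Rbar (a%:F / b%:F)).
Proof.
move=> Jx0 x0n0.
have [n hn] := length_exists R_noetherian R_local R_dim1 Jx0 x0n0.
have pl (a : R) : a != 0 -> exists p, length_is (line (a : R^o)) full p.
  by move=> a0; apply: (length_exists R_noetherian R_local R_dim1 (line_id (a : R^o))).
rewrite (mod_length_quotE hn); split=> [/h_invP[_ hmin] a b a0 b0 hab|h].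
  apply: contrapT => nab.
  have /choice[f hf] : forall j : submod_of J, exists t : R, a * \val j = b * t.
    move=> j; have /hab/pidealP[t tE] : a * \val j \in sub_scale a J.
      by apply/ideal_scaleP; exists (\val j) => //; apply: valP.
    by exists t.
  have lf : linear (f : submod_of J -> R^o).
    move=> r u v; apply: (mulfI b0).
    transitivity (a * (r * \val u + \val v) : R); first by rewrite -hf.
    transitivity (b * (r * f u + f v) : R); last by [].
    by rewrite !mulrDr mulrCA hf mulrCA hf.
  have [phi phiE] := linear_map lf.
  have E x : x \in sub_scale a J <-> x \in sub_scale b (lin_image phi).
    split=> /ideal_scaleP[s Js ->]; apply/ideal_scaleP.
      exists (f (exist _ s Js)); last by rewrite -hf.
      by apply/lin_imageP; exists (exist _ s Js).
    move: Js => /lin_imageP[j <-]; exists (\val j); first exact: valP.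
    by rewrite phiE -hf.
  have [p hp] := pl a a0; have [q hq] := pl b b0.
  have pq := length_principal_lt a0 b0 hp hq nab.
  have im0 : f (exist _ x0 Jx0) \in lin_image phi.
    by apply/lin_imageP; exists (exist _ x0 Jx0).
  have fx0 : f (exist _ x0 Jx0) != 0.
    have : b * f (exist _ x0 Jx0) != 0 by rewrite -hf mulf_neq0.
    by rewrite mulf_eq0 negb_or => /andP[].
  have [n' hn'] := length_exists R_noetherian R_local R_dim1 im0 fx0.
  have := length_isomorphic_ideals a0 b0 E hn hn' hp hq.
  have := hmin phi; rewrite (mod_length_quotE hn') lee_fin lez_nat; move: pq; clear; lia.
apply/h_invP; split.
  have lv : linear (fun j : submod_of J => \val j : R^o) by [].
  have [phi phiE] := linear_map lv; exists phi; apply/esym/mod_length_quotE.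
  have e : length_is (lin_image phi) J 0.
    apply: length_is_eq => x; last first.
      by move=> Jx; apply/lin_imageP; exists (exist _ x Jx).
    by move=> /lin_imageP[j <-]; rewrite phiE; apply: valP.
  exact: (length_isD e hn).
move=> psi; have [->|[n' hn' ->]] := mod_length_quot_dichotomy (lin_image psi).
  exact: leey.
rewrite lee_fin lez_nat.
pose j0 : submod_of J := exist _ x0 Jx0.
have comm (j : submod_of J) : x0 * psi j = psi j0 * \val j.
  rewrite -[LHS]/(x0 *: psi j) -linearZ mulrC -[RHS]/(\val j *: psi j0) -linearZ.
  by congr (psi _); apply: val_inj; rewrite -[LHS]/(x0 * \val j) mulrC.
have [psi0|psi0] := eqVneq (psi j0) 0.
  apply/(length_isP hn'); apply: length_ge_widenl (proj1 hn) _.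
  move=> _ /lin_imageP[j <-].
  have /eqP : x0 * psi j = 0 by rewrite comm psi0 mul0r.
  by rewrite mulf_eq0 (negPf x0n0) => /eqP ->; apply: ideal0.
have E x : x \in sub_scale (psi j0 : R) J <-> x \in sub_scale x0 (lin_image psi).
  split=> /ideal_scaleP[s Js ->]; apply/ideal_scaleP.
    exists (psi (exist _ s Js)); last by rewrite comm.
    by apply/lin_imageP; exists (exist _ s Js).
  move: Js => /lin_imageP[j <-]; exists (\val j); first exact: valP.
  by rewrite comm.
have [p hp] := pl _ psi0; have [q hq] := pl _ x0n0.
have := length_isomorphic_ideals psi0 x0n0 E hn hn' hp hq.
suff qp : (q <= p)%N by move=> E'; move: qp E'; clear; lia.
apply: (length_principal_le psi0 x0n0 hp hq); apply: h => //.
move=> _ /ideal_scaleP[j Jj ->]; apply/pidealP; exists (psi (exist _ j Jj)).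
by rewrite comm.
Qed.

End LengthComparison.

(** * Duality from a finite injective resolution *)

Section Extension.
Variables (R : idomainType) (m : submodClosed R^o).
Hypothesis R_noetherian : noetherian R.
Hypothesis R_local : local_ring m.
Hypothesis R_dim1 : krull_dim R = 1%:E.
Implicit Types (I J : submodClosed R^o) (x y r s b : R).

(** A homomorphism defined on [I] is represented by a function on all of [R],
    whose values outside [I] are irrelevant. *)
Definition linear_on (V : lmodType R) I (f : R -> V) :=
  forall r x y, x \in I -> y \in I -> f (r * x + y) = r *: f x + f y.

Section LinearOn.
Variables (V : lmodType R) (I : submodClosed R^o) (f : R -> V).
Hypothesis lf : linear_on I f.

Lemma linear_on0 : f 0 = 0.
Proof.
have := lf 1 (ideal0 I) (ideal0 I); rewrite mul1r addr0 scale1r => /eqP.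
by rewrite -subr_eq subrr eq_sym => /eqP.
Qed.

Lemma linear_onZ r x : x \in I -> f (r * x) = r *: f x.
Proof. by move=> Ix; have := lf r Ix (ideal0 I); rewrite linear_on0 !addr0. Qed.

Lemma linear_onB x y : x \in I -> y \in I -> f (x - y) = f x - f y.
Proof.
move=> Ix Iy; rewrite addrC -mulN1r lf // scaleN1r addrC //.
Qed.

Lemma linear_on_comm x y : x \in I -> y \in I -> x *: f y = y *: f x.
Proof. by move=> Ix Iy; rewrite -!linear_onZ // mulrC. Qed.

Lemma linear_on_adjoin b z : (forall r, r * b \in I -> f (r * b) = r *: z) ->
  exists g : R -> V, [/\ linear_on (adjoin I (b : R^o)) g,
    forall a, a \in I -> g a = f a & g b = z].
Proof.
move=> hz; have /choice[g hg] : forall u : R, exists v, forall a r, a \in I ->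
    u = a + r * b -> v = f a + r *: z.
  move=> u; have [[a [r [Ia uE]]]|h] := pselect (exists a r : R, a \in I /\ u = a + r * b).
    exists (f a + r *: z) => a' r' Ia' uE'.
    have E : a' - a = (r - r') * b.
      by rewrite mulrBl; apply/eqP; rewrite subr_eq addrAC eq_sym subr_eq addrC -uE' uE addrC.
    have : f (a' - a) = (r - r') *: z.
      by rewrite E hz // -E; apply: ideal_sub.
    rewrite linear_onB // scalerBl => /eqP; rewrite subr_eq addrAC eq_sym subr_eq => /eqP <-.
    exact: addrC.
  by exists 0 => a r Ia uE; case: h; exists a, r.
exists g; split=> [r u v /adjoinP[a [s [Ia ->]]] /adjoinP[a' [s' [Ia' ->]]]|a Ia|].
- rewrite (hg (a + s *: (b : R^o)) a s) // (hg (a' + s' *: (b : R^o)) a' s') //.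
  rewrite (hg _ (r * a + a') (r * s + s')).
  + by rewrite lf // scalerDr scalerDl scalerA addrACA.
  + by apply: ideal_add => //; apply: ideal_mull.
  + rewrite -[(a + _ : R^o)]/(a + s * b : R) -[(a' + _ : R^o)]/(a' + s' * b : R).
    by rewrite mulrDr mulrDl mulrA addrACA.
- by rewrite (hg a a 0) // ?scale0r ?addr0 // mul0r addr0.
- by rewrite (hg b 0 1) ?ideal0 // ?linear_on0 ?scale1r ?add0r // mul1r.
Qed.

End LinearOn.

Lemma injective_extend (E : lmodType R) I (f : R -> E) : injective_module E ->
  linear_on I f -> exists e, forall a, a \in I -> f a = a *: e.
Proof.
move=> injE lf.
have lv : linear (fun j : submod_of I => \val j : R^o) by [].
have [i iE] := linear_map lv.
have lg : linear (fun j : submod_of I => f (\val j)).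
  by move=> r u v; apply: lf; apply: valP.
have [g gE] := linear_map lg.
have [|h hE] := injE (submod_of I) R^o i g.
  by move=> u v; rewrite !iE; apply: val_inj.
exists (h (1 : R^o)) => a Ia; have := hE (exist _ a Ia).
rewrite gE iE /= => <-; rewrite -linearZ; congr (h _).
by rewrite -[RHS]/(a * 1) mulr1.
Qed.

Lemma injective_divisible (E : lmodType R) y (e : E) : injective_module E ->
  y != 0 -> exists e', y *: e' = e.
Proof.
move=> injE y0.
have /choice[q hq] : forall u : R, exists r, u \in line (y : R^o) -> u = y * r.
  move=> u; have [/pidealP[r ->]|nu] := boolP (u \in line (y : R^o)); first by exists r.
  by exists 0.
have lf : linear_on (line (y : R^o)) (fun u => q u *: e).
  move=> r u v hu hv; rewrite scalerA -scalerDl; congr (_ *: _); apply: (mulfI y0).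
  rewrite -hq; first by rewrite {1}(hq u) // {1}(hq v) // mulrDr mulrCA.
  by apply: ideal_add => //; apply: ideal_mull.
have [e' he'] := injective_extend injE lf; exists e'.
rewrite -he' ?line_id // [q y](_ : _ = 1) ?scale1r //.
by apply: (mulfI y0); rewrite mulr1 -hq //; apply: line_id.
Qed.

(** Injectivity in the form of Baer's criterion, which is all that is used of the
    cosyzygies. *)
Definition baer_injective (V : lmodType R) (Z : submodClosed V) :=
  forall I (f : R -> V), linear_on I f -> (forall a, a \in I -> f a \in Z) ->
  exists2 z, z \in Z & forall a, a \in I -> f a = a *: z.

(** In dimension one it suffices to test the maximal ideal, by climbing a
    composition series of [R/I]. *)
Lemma baer_injective_max (V : lmodType R) (Z : submodClosed V) :
  (forall g : R -> V, linear_on m g -> (forall r, r \in m -> g r \in Z) ->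
    exists2 z, z \in Z & forall r, r \in m -> g r = r *: z) ->
  baer_injective Z.
Proof.
move=> hm I f lf fZ.
have [[x Ix x0]|h] := pselect (exists2 x : R, x \in I & x != 0); last first.
  exists 0 => [|a Ia]; first exact: rpred0.
  have [->|a0] := eqVneq a 0; first by rewrite (linear_on0 lf) scaler0.
  by case: h; exists a.
have [n hn] := comp_series_exists R_noetherian R_local R_dim1 Ix x0.
elim: hn f lf fZ {x Ix x0} => {I n} [I I1|I b n nb mb _ IH] f lf fZ.
  exists (f 1); first exact: fZ.
  by move=> a _; rewrite -(linear_onZ lf) // mulr1.
have [||zb Zzb hzb] := hm (fun r => f (r * b)).
- by move=> r u v mu mv; rewrite mulrDl -mulrA lf //; apply: mb.
- by move=> r mr; apply: fZ; apply: mb.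
have [|g [lg gf gb]] := linear_on_adjoin lf (b := b) (z := zb).
  move=> r rb; apply: hzb; apply: contraLR rb => nr.
  by apply: contra nb; apply: (mul_notin_max R_noetherian R_local nr).
have [|z Zz hz] := IH g lg.
  move=> _ /adjoinP[a [r [Ia ->]]].
  rewrite [a + _](_ : _ = (r * b + a : R)); last by rewrite addrC.
  rewrite lg; [|exact: adjoin_id|exact: adjoin_sub].
  by rewrite gb gf // rpredD ?rpredZ ?fZ.
by exists z => // a Ia; rewrite -gf // hz //; apply: adjoin_sub.
Qed.

Section Resolution.
Variables (M : lmodType R) (E : injective_resolution M).

Lemma submodule_set_cosyzygy n : submodule_set (fun y : E n => inj_diff E n y = 0).
Proof.
by split=> [|a u v hu hv]; rewrite ?linear0 // linearP hu hv scaler0 addr0.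
Qed.
Definition cosyzygy n := Submodule (submodule_set_cosyzygy n).

Lemma cosyzygyP n (y : E n) : reflect (inj_diff E n y = 0) (y \in cosyzygy n).
Proof. exact: in_SubmoduleP. Qed.

Lemma inj_diffK n (y : E n) : inj_diff E n.+1 (inj_diff E n y) = 0.
Proof. by apply/inj_exactS; exists y. Qed.

Lemma cosyzygy_divisible n y (z : E n.+1) : y != 0 -> z \in cosyzygy n.+1 ->
  exists2 z', z' \in cosyzygy n.+1 & y *: z' = z.
Proof.
move=> y0 /cosyzygyP/inj_exactS[e ->].
have [e' <-] := injective_divisible e (@inj_termP R M E n) y0.
by exists (inj_diff E n e'); [apply/cosyzygyP/inj_diffK|rewrite linearZ].
Qed.

(** Dimension shifting: for the residue field [k] embedded in [R/xR] as a socle,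
    [Ext^1(R/xR, Z) = Z/xZ] vanishes by divisibility and surjects onto
    [Ext^1(k, Z)] because the next cosyzygy is injective. *)
Lemma cosyzygy_step n : baer_injective (cosyzygy n.+2) -> baer_injective (cosyzygy n.+1).
Proof.
move=> inj2; apply: baer_injective_max => g lg gZ.
have [e he] := injective_extend (@inj_termP R M E n.+1) lg.
set d := inj_diff E n.+1; pose eb := d e.
have ebm r : r \in m -> r *: eb = 0.
  by move=> mr; rewrite -linearZ -he //; apply/cosyzygyP/gZ.
have [x mx x0] := max_nonzero R_noetherian R_local R_dim1.
have [s ns ms] : exists2 s : R, s \notin line (x : R^o) &
    forall r, r \in m -> r * s \in line (x : R^o).
  apply: (socle_exists R_noetherian R_local R_dim1 (line_id (x : R^o)) x0).
  apply/negP => /(pideal_min mx); apply/negP; exact: max_proper R_local.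
have l0 : linear_on (line (x : R^o)) (fun _ : R => 0 : E n.+2).
  by move=> r u v _ _; rewrite scaler0 addr0.
have [|h [lh h0 hs]] := linear_on_adjoin l0 (b := s) (z := eb).
  move=> r rs; rewrite ebm //; apply: contraLR rs => nr.
  by apply: contra ns; apply: (mul_notin_max R_noetherian R_local nr).
have [|z Zz hz] := inj2 _ h lh.
  move=> _ /adjoinP[a [r [Ia ->]]].
  rewrite [a + _](_ : _ = (r * s + a : R)); last by rewrite addrC.
  rewrite lh; [|exact: adjoin_id|exact: adjoin_sub].
  by rewrite hs h0 // addr0 rpredZ //; apply/cosyzygyP/inj_diffK.
have xz : x *: z = 0 by rewrite -hz ?h0 ?line_id //; apply: adjoin_sub; apply: line_id.
have sz : s *: z = eb by rewrite -hz ?hs //; apply: adjoin_id.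
have [ep epE] : exists ep, z = d ep by apply/inj_exactS/cosyzygyP.
have [z' Zz' xz'] : exists2 z', z' \in cosyzygy n.+1 & x *: z' = x *: ep.
  by apply: cosyzygy_divisible => //; apply/cosyzygyP; rewrite linearZ -/d -epE.
exists (e - s *: (ep - z')) => [|r mr].
  apply/cosyzygyP; rewrite linearB linearZ /= linearB -/d -epE.
  by move/cosyzygyP: Zz'; rewrite -/d => ->; rewrite subr0 sz subrr.
have /pidealP[t rs] := ms _ mr.
by rewrite scalerBr -he // scalerA rs mulrC -scalerA scalerBr xz' subrr scaler0 subr0.
Qed.

Lemma cosyzygy_injective N : (forall i, (N < i)%N -> forall x : E i, x = 0) ->
  forall n, baer_injective (cosyzygy n.+1).
Proof.
move=> hN n; suff h k : forall n, (N <= n + k)%N -> baer_injective (cosyzygy n.+1).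
  by apply: (h N); apply: leq_addl.
elim: k => {n} [|k IH] n Nn.
  rewrite addn0 in Nn; move=> I f lf fZ; exists 0; first exact: rpred0.
  by move=> a Ia; rewrite scaler0; apply: hN.
by apply: cosyzygy_step; apply: IH; rewrite addSnnS.
Qed.

Hypothesis torsion_free : forall y (v : M), y != 0 -> y *: v = 0 -> v = 0.

Lemma torsion_freeI y : y != 0 -> injective (fun v : M => y *: v).
Proof.
move=> y0 u v /= uv; apply/eqP; rewrite -subr_eq0; apply/eqP.
by apply: (torsion_free y0); rewrite scalerBr uv subrr.
Qed.

(** Fractions of elements of [M] are represented in [E 0]: here [e] plays the role
    of [w/y], which is a socle element of [(K M)/M]. *)
Lemma socle_lift y (w : M) : y != 0 -> (forall r, r \in m -> exists u, r *: w = y *: u) ->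
  exists e : E 0%N, forall r u, r \in m -> r *: w = y *: u -> r *: e = inj_aug E u.
Proof.
move=> y0 hw.
have /choice[q hq] : forall r : R, exists u, r \in m -> r *: w = y *: u.
  move=> r; have [/hw[u uE]|nr] := boolP (r \in m); first by exists u.
  by exists 0.
have lf : linear_on m (fun r => inj_aug E (q r)).
  move=> r u v mu mv; rewrite -linearP; congr (inj_aug E _).
  apply: (torsion_freeI y0); rewrite /= -hq; last first.
    by apply: ideal_add => //; apply: ideal_mull.
  by rewrite scalerDl -scalerA hq // (hq v) // scalerDr !scalerA mulrC.
have [e he] := injective_extend (@inj_termP R M E 0%N) lf; exists e => r u mr rw.
rewrite -he //; congr (inj_aug E _); apply: (torsion_freeI y0).
by rewrite /= -hq.
Qed.

(** The duality carried by [M]. Let [b] be a multiple of [s] which is a socle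
    element of [(I + Rs)/I]. Since [E 0 / M] is Baer injective and has a non-zero
    socle, there is a homomorphism from [I + Rb] to [E 0 / M] killing [I] but not
    [b], and it is multiplication by an element of [E 0]. This element multiplies
    [I] into [M], which defines [psi], but not [b]; so [s psi a / a] cannot lie in
    [M]. *)
Lemma nonextendable_hom N x (v0 : M) I a0 s :
  (forall i, (N < i)%N -> forall x : E i, x = 0) ->
  x \in m -> x != 0 -> (forall u, x *: u <> v0) ->
  a0 \in I -> a0 != 0 -> s \notin I ->
  exists psi : R -> M, linear_on I psi /\
    forall a w, a \in I -> a != 0 -> a *: w <> s *: psi a.
Proof.
move=> hN mx x0 hv0 Ia0 a0n0 ns; have inj1 := cosyzygy_injective hN (n := 0%N).
have [w0 hw0 mw0] : exists2 w0 : M, (forall u, x *: u <> w0) &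
    forall r, r \in m -> exists u, r *: w0 = x *: u.
  have QP : submodule_set (fun r : R^o => exists u, (r : R) *: v0 = x *: u).
    split=> [|a r t [u uE] [v vE]]; first by exists 0; rewrite scaler0 scale0r.
    exists (a *: u + v); rewrite -[_ *: r + t]/(a * r + t : R).
    by rewrite scalerDl -scalerA uE vE scalerDr !scalerA mulrC.
  pose Q := Submodule QP.
  have inQ (r : R) : reflect (exists u, r *: v0 = x *: u) (r \in Q).
    exact: (in_SubmoduleP QP).
  have Qx : x \in Q by apply/inQ; exists v0.
  have nQ1 : 1 \notin Q.
    by apply/negP => /inQ[u]; rewrite scale1r => /esym/hv0.
  have [c nc mc] := socle_exists R_noetherian R_local R_dim1 Qx x0 nQ1.
  exists (c *: v0) => [u uE|r /mc/inQ[u uE]]; last by exists u; rewrite scalerA.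
  by move/negP: nc; apply; apply/inQ; exists u.
have [e he] := socle_lift x0 mw0.
have xe : x *: e = inj_aug E w0 by apply: he.
pose eb := inj_diff E 0 e.
have ebm r : r \in m -> r *: eb = 0.
  move=> mr; have [u uE] := mw0 _ mr.
  by rewrite -linearZ (he r u) //; apply/inj_exact0; exists u.
have [r nr mr] : exists2 r : R, r \notin colon I s & forall k, k \in m -> k * r \in colon I s.
  apply: (socle_exists R_noetherian R_local R_dim1 (x := a0)) => //.
    by apply/colonP; apply: ideal_mulr.
  by apply/negP => /colonP; rewrite mul1r; apply/negP.
pose b := r * s.
have nb : b \notin I by apply/negP => /colonP; apply/negP.
have mb k : k \in m -> k * b \in I by move=> /mr/colonP; rewrite mulrA.
have l0 : linear_on I (fun _ : R => 0 : E 1%N).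
  by move=> t u v _ _; rewrite scaler0 addr0.
have [|h [lh h0 hb]] := linear_on_adjoin l0 (b := b) (z := eb).
  move=> t tb; rewrite ebm //; apply: contraLR tb => nt.
  by apply: contra nb; apply: (mul_notin_max R_noetherian R_local nt).
have [|z Zz hz] := inj1 _ h lh.
  move=> _ /adjoinP[a [t [Ia ->]]].
  rewrite [a + _](_ : _ = (t * b + a : R)); last by rewrite addrC.
  rewrite lh; [|exact: adjoin_id|exact: adjoin_sub].
  by rewrite hb h0 // addr0 rpredZ //; apply/cosyzygyP/inj_diffK.
have az a : a \in I -> a *: z = 0 by move=> Ia; rewrite -hz ?h0 //; apply: adjoin_sub.
have bz : b *: z = eb by rewrite -hz ?hb //; apply: adjoin_id.
have [ep epE] : exists ep, z = inj_diff E 0 ep by apply/inj_exactS/cosyzygyP.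
have /choice[psi hpsi] : forall a : R, exists u, a \in I -> a *: ep = inj_aug E u.
  move=> a; have [Ia|nIa] := boolP (a \in I); last by exists 0.
  have [u uE] : exists u, a *: ep = inj_aug E u.
    by apply/inj_exact0; rewrite linearZ /= -epE az.
  by exists u.
have lpsi : linear_on I psi.
  move=> t u v Iu Iv; apply: (inj_aug_injective (i := E)).
  rewrite -hpsi; last by apply: ideal_add => //; apply: ideal_mull.
  by rewrite scalerDl -scalerA !hpsi // linearP.
have [w1 w1E] : exists w1, b *: ep - e = inj_aug E w1.
  by apply/inj_exact0; rewrite linearB linearZ /= -epE bz subrr.
exists psi; split=> // a w Ia a0' aw.
have key k : k \in m -> psi (k * b) = k *: (r *: w).
  move=> mk; apply: (torsion_freeI a0') => /=.
  rewrite (linear_on_comm lpsi) ?mb // /b -!scalerA -aw !scalerA; congr (_ *: _).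
  by rewrite mulrC mulrA.
apply: (hw0 (r *: w - w1)); apply: (inj_aug_injective (i := E)).
rewrite scalerBr linearB -key // -hpsi ?mb // linearZ /= -w1E scalerBr -xe.
by rewrite opprB addrC -addrA scalerA addNr addr0.
Qed.

End Resolution.

End Extension.

(** * A module of type one has rank one *)

Section CanonicalModule.
Variables (R : idomainType) (m : submodClosed R^o).
Hypothesis R_noetherian : noetherian R.
Hypothesis R_local : local_ring m.
Hypothesis R_dim1 : krull_dim R = 1%:E.
Implicit Types (I J : submodClosed R^o) (x y r s a b : R).
Variable M : lmodType R.
Implicit Types (u v w : M).
Local Notation full := (full_submod R^o).

Lemma ideal_mul_zero_gens (N : submodClosed M) v :
  v \in ideal_mul (gen_ideal [::]) N -> v = 0.
Proof.
move=> h; apply/in_zero; move: v h; apply: span_min => _ [a [v [ha _ ->]]].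
have /in_zero -> : a \in zero_submod R^o by apply: span_min ha.
by rewrite scale0r rpred0.
Qed.

Lemma depth_one : depth m M = 1%:E ->
  exists x, [/\ x \in m, x != 0, forall v, x *: v = 0 -> v = 0 &
    exists v0, forall u, x *: u <> v0].
Proof.
move=> /nat_sup_mem[[|x [|? ?]] [] // _ sm [reg [v0 nv0]]].
have xreg v : x *: v = 0 -> v = 0.
  move=> xv; apply: (@ideal_mul_zero_gens (full_submod M)).
  by apply: (reg 0%N isT v); rewrite xv; apply: rpred0.
have nx u : x *: u <> v0.
  move=> xu; move/negP: nv0; apply; apply: span_gen; exists x, u; split=> //.
    by apply: span_gen; rewrite inE.
  exact: in_full.
exists x; split=> //; [by apply: sm; rewrite inE| |by exists v0].
apply/eqP => x0; apply: (nx v0); rewrite x0 scale0r.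
by apply/esym/xreg; rewrite x0 scale0r.
Qed.

Lemma regular_torsion_free x : x \in m -> (forall v, x *: v = 0 -> v = 0) ->
  forall y v, y != 0 -> y *: v = 0 -> v = 0.
Proof.
move=> mx xreg y v y0 yv.
have [n /pidealP[t xn]] := pow_in_ideal R_noetherian R_local R_dim1 mx (line_id (y : R^o)) y0.
have : x ^+ n *: v = 0 by rewrite xn mulrC -scalerA yv scaler0.
elim: n {xn} => [|n IH]; first by rewrite scale1r.
by rewrite exprS -scalerA => /xreg.
Qed.

Lemma mul_notin_max_mod (U : submodClosed M) r v : r \notin m -> r *: v \in U -> v \in U.
Proof.
move=> /(notin_max_unit R_noetherian R_local)[s rs] /(rpredZ s).
by rewrite scalerA mulrC rs scale1r.
Qed.

Section TypeOne.
Hypothesis torsion_free : forall y v, y != 0 -> y *: v = 0 -> v = 0.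
Variable E : injective_resolution M.
Hypothesis ext1 : isomorphic (Ext (quot_mod m) E 1) (quot_mod m).

Lemma residue_cocycle (e : E 0%N) :
  (forall r, r \in m -> r *: inj_diff E 0 e = 0) ->
  exists f : quot_mod m -> E 1%N, [/\ linear f, forall q, inj_diff E 1 (f q) = 0 &
    forall r, f (proj_quot m (r : R^o)) = r *: inj_diff E 0 e].
Proof.
move=> em; pose f (q : quot_mod m) : E 1%N := (repr q : R) *: inj_diff E 0 e.
have fE (r : R) : f (proj_quot m (r : R^o)) = r *: inj_diff E 0 e.
  apply/eqP; rewrite -subr_eq0 -scalerBl; apply/eqP/em.
  by apply/proj_quot_eq; rewrite proj_quotK.
exists f; split=> // [c q q'|q]; last by rewrite linearZ /= inj_diffK scaler0.
rewrite -(proj_quotK q) -(proj_quotK q').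
have -> : c *: proj_quot m (repr q) + proj_quot m (repr q') =
    proj_quot m ((c * (repr q : R) + (repr q' : R) : R) : R^o).
  by rewrite proj_quotD (proj_quotZ m c (repr q)).
by rewrite !fE scalerDl scalerA.
Qed.

(** Since [Ext^1(k, M)] is one-dimensional over the residue field, so is the socle
    of [M/yM], which embeds in it through the connecting homomorphism. *)
Lemma socle_dependent y w1 w2 : y != 0 ->
  (forall r, r \in m -> exists u, r *: w1 = y *: u) ->
  (forall r, r \in m -> exists u, r *: w2 = y *: u) ->
  exists a1 a2, (a1 \notin m \/ a2 \notin m) /\ exists u, a1 *: w1 + a2 *: w2 = y *: u.
Proof.
move=> y0 h1 h2.
have lift w : (forall r, r \in m -> exists u, r *: w = y *: u) ->
    exists e : E 0%N, (forall r u, r \in m -> r *: w = y *: u -> r *: e = inj_aug E u) /\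
    exists f : quot_mod m -> E 1%N, [/\ linear f, forall q, inj_diff E 1 (f q) = 0 &
      forall r, f (proj_quot m (r : R^o)) = r *: inj_diff E 0 e].
  move=> hw; have [e he] := socle_lift E torsion_free y0 hw.
  exists e; split=> //; apply: residue_cocycle => r mr.
  have [u uE] := hw _ mr; rewrite -linearZ (he r u) //.
  by apply/inj_exact0; exists u.
have [e1 [he1 [f1 [lf1 df1 f1E]]]] := lift _ h1.
have [e2 [he2 [f2 [lf2 df2 f2E]]]] := lift _ h2.
have c1 : f1 \in @cocycles R (quot_mod m) M E 1 by apply/in_SubmoduleP.
have c2 : f2 \in @cocycles R (quot_mod m) M E 1 by apply/in_SubmoduleP.
pose z1 : submod_of (@cocycles R (quot_mod m) M E 1) := exist _ f1 c1.
pose z2 : submod_of (@cocycles R (quot_mod m) M E 1) := exist _ f2 c2.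
have [F bF] := ext1; have injF := bij_inj bF.
pose cl := proj_quot (@coboundaries R (quot_mod m) M E 1).
have [a1 [a2 [na aF]]] : exists a1 a2 : R, (a1 \notin m \/ a2 \notin m) /\
    a1 *: F (cl z1) + a2 *: F (cl z2) = 0.
  pose k1 : R := repr (F (cl z1)); pose k2 : R := repr (F (cl z2)).
  have E1 : F (cl z1) = proj_quot m (k1 : R^o) by rewrite proj_quotK.
  have E2 : F (cl z2) = proj_quot m (k2 : R^o) by rewrite proj_quotK.
  have comb a1 a2 : a1 * k1 + a2 * k2 \in m -> a1 *: F (cl z1) + a2 *: F (cl z2) = 0.
    move=> hm; rewrite E1 E2; transitivity (proj_quot m ((a1 * k1 + a2 * k2 : R) : R^o)).
      by rewrite proj_quotD (proj_quotZ m a1 k1) (proj_quotZ m a2 k2).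
    by rewrite -(proj_quot0 m); apply/proj_quot_eq; rewrite subr0.
  (* Two elements [k1] and [k2] of the residue field satisfy [k2 k1 - k1 k2 = 0];
     this relation is trivial only if both vanish. *)
  have [mk1|nk1] := boolP (k1 \in m).
    exists 1, 0; split; first by left; apply: max_proper R_local.
    by apply: comb; rewrite mul1r mul0r addr0.
  exists k2, (- k1); split.
    by right; apply: contra nk1 => /ideal_opp; rewrite opprK.
  by apply: comb; rewrite mulNr mulrC subrr; apply: ideal0.
exists a1, a2; split=> //.
have cl0 : cl (a1 *: z1 + a2 *: z2) = 0.
  have clE : cl (a1 *: z1 + a2 *: z2) = a1 *: cl z1 + a2 *: cl z2.
    by rewrite /cl proj_quotD !proj_quotZ.
  by apply: injF; rewrite clE linearD !linearZ aF linear0.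
have /in_SubmoduleP[g lg hg] : a1 *: z1 + a2 *: z2 \in
    @coboundaries R (quot_mod m) M E 1.
  by rewrite -[_ + _]subr0; apply/proj_quot_eq; rewrite proj_quot0.
pose e' := g (proj_quot m (1 : R^o)).
have e'm r : r \in m -> r *: e' = 0.
  move=> mr; have [gl glE] := linear_map lg.
  rewrite /e' -glE -linearZ.
  have -> : r *: proj_quot m (1 : R^o) = 0.
    transitivity (proj_quot m ((r * 1 : R) : R^o)).
      exact: (esym (proj_quotZ m r (1 : R^o))).
    by rewrite mulr1 -(proj_quot0 m); apply/proj_quot_eq; rewrite subr0.
  by rewrite linear0.
have [u uE] : exists u, a1 *: e1 + a2 *: e2 - e' = inj_aug E u.
  apply/inj_exact0; rewrite linearB linearD !linearZ /= -(hg (proj_quot m (1 : R^o))).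
  rewrite -[\val _ _]/(a1 *: f1 (proj_quot m (1 : R^o)) + a2 *: f2 (proj_quot m (1 : R^o))).
  by rewrite f1E f2E !scale1r subrr.
exists u.
have [x mx x0] := max_nonzero R_noetherian R_local R_dim1.
have [u1 xu1] := h1 _ mx; have [u2 xu2] := h2 _ mx.
have xu : x *: u = a1 *: u1 + a2 *: u2.
  apply: (inj_aug_injective (i := E)).
  rewrite linearZ linearD !linearZ /= -uE -(he1 _ _ mx xu1) -(he2 _ _ mx xu2).
  by rewrite scalerBr e'm // subr0 scalerDr !scalerA !(mulrC x).
apply: (torsion_freeI torsion_free x0) => /=.
rewrite scalerA (mulrC x y) -scalerA xu !scalerDr !scalerA !(mulrC y) -!scalerA.
by rewrite -xu1 -xu2 !scalerA !(mulrC x).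
Qed.

Lemma submodule_set_multiplier y I :
  submodule_set (fun w : M => forall i, i \in I -> exists u, i *: w = y *: u).
Proof.
split=> [i _|r v w hv hw i Ii]; first by exists 0; rewrite !scaler0.
have [u uE] := hv _ Ii; have [u' uE'] := hw _ Ii.
by exists (r *: u + u'); rewrite !scalerDr -uE' !scalerA (mulrC i) (mulrC y) -!scalerA uE.
Qed.
Definition multiplier y I := Submodule (submodule_set_multiplier y I).

Lemma multiplierP y I w :
  reflect (forall i, i \in I -> exists u, i *: w = y *: u) (w \in multiplier y I).
Proof. exact: in_SubmoduleP. Qed.

(** As the socle of [M/yM] is simple, each step of a composition series of [R/I]
    adds at most one to the length of the annihilator of [I] in [M/yM]. *)
Lemma length_multiplier y I n k : y != 0 -> comp_series m I n ->
  length_ge k (sub_scale y (full_submod M)) (multiplier y I) -> (k <= n)%N.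
Proof.
move=> y0 hn; elim: hn k => {I n} [I I1|I b n nb mb _ IH] k.
  case: k => // k [U /length_ge_sub AU [_]]; case=> w /multiplierP/(_ _ I1)[u].
  by rewrite scale1r => ->; apply: AU; apply/sub_scaleP; exists u => //; apply: in_full.
set I' := adjoin I (b : R^o) => hk.
have /(length_ge_split hk)[p [q [<- hp hq]]] :
    {subset sub_scale y (full_submod M) <= multiplier y I'}.
  move=> _ /sub_scaleP[u _ ->]; apply/multiplierP => i _.
  by exists (i *: u); rewrite !scalerA mulrC.
have pn : (p <= n)%N.
  by apply: IH; apply: length_ge_widenr hp _ => w /sub_capP[].
suff q1 : (q <= 1)%N by rewrite addnC -add1n leq_add.
rewrite leqNgt; apply/negP => /(length_ge_le hq)[U [U0 hU0 [U0U nUU0]] [UT nTU]].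
have IT : {subset sub_add (multiplier y I) (multiplier y I') <= multiplier y I}.
  apply: sub_add_min => // w /multiplierP hw; apply/multiplierP => i Ii.
  by apply: hw; apply: adjoin_sub.
have [w1 Uw1 nw1] := not_subset nUU0; have [w2 Tw2 nw2] := not_subset nTU.
have /multiplierP Iw1 := IT _ (UT _ Uw1); have /multiplierP Iw2 := IT _ Tw2.
have soc w : (forall i, i \in I -> exists u, i *: w = y *: u) ->
    forall r, r \in m -> exists u, r *: (b *: w) = y *: u.
  by move=> hw r /mb/hw[u uE]; exists u; rewrite scalerA.
have [a1 [a2 [na [u uE]]]] := socle_dependent y0 (soc _ Iw1) (soc _ Iw2).
have inI' w : (forall i, i \in I -> exists u, i *: w = y *: u) ->
    (exists u, b *: w = y *: u) -> w \in multiplier y I'.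
  move=> hw [u' bw]; apply/multiplierP => _ /adjoinP[i [r [/hw[v vE] ->]]].
  exists (v + r *: u'); rewrite -[i + _]/(i + r * b) scalerDl vE scalerDr.
  by rewrite -scalerA bw !scalerA mulrC.
have hcomb : a1 *: w1 + a2 *: w2 \in multiplier y I'.
  apply: inI'; last by exists u; rewrite scalerDr !scalerA !(mulrC b) -!scalerA.
  by move=> i Ii; apply/multiplierP: i Ii; rewrite rpredD ?rpredZ //; apply/multiplierP.
have I'U0 : {subset multiplier y I' <= U0} := hU0.
have [ma2|na2] := boolP (a2 \in m); last first.
  move/negP: nw2; apply; apply: (mul_notin_max_mod na2).
  by rewrite -(addKr (a1 *: w1) (a2 *: w2)) rpredD ?submodN ?rpredZ //; apply/U0U/I'U0.
have na1 : a1 \notin m by case: na => //; rewrite ma2.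
move/negP: nw1; apply; apply: (mul_notin_max_mod na1).
rewrite -(addrK (a2 *: w2) (a1 *: w1)) submodB //; first exact: I'U0.
apply: I'U0; apply: inI'; last first.
  by have [u' uE'] := soc _ Iw2 _ ma2; exists u'; rewrite -uE' !scalerA mulrC.
by move=> i Ii; apply/multiplierP: i Ii; rewrite rpredZ //; apply/multiplierP.
Qed.

Lemma length_quotient_le y n k : y != 0 ->
  length_is (line (y : R^o)) full n ->
  length_ge k (sub_scale y (full_submod M)) (full_submod M) -> (k <= n)%N.
Proof.
move=> y0 hn hk.
have [n' hn'] := comp_series_exists R_noetherian R_local R_dim1 (line_id (y : R^o)) y0.
have -> : n = n' by apply: length_is_uniq hn (comp_series_length R_noetherian R_local hn').
apply: length_multiplier y0 hn' _; apply: length_ge_widenr hk _ => w _.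
apply/multiplierP => _ /pidealP[r ->]; exists (r *: w); by rewrite scalerA.
Qed.

End TypeOne.

(** In a finitely generated module, an element without torsion is separated from
    zero by a linear functional: keep those generators which do not create a
    relation with [alpha]; modulo their span, every generator is a multiple of
    [alpha] up to a denominator. *)
Lemma torsionless alpha : finitely_generated M -> (forall a, a *: alpha = 0 -> a = 0) ->
  exists p : {linear M -> R^o}, p alpha != 0 :> R.
Proof.
move=> [gs hgs] ha.
have [N [d [d0 hN hd]]] : exists (N : submodClosed M) d, [/\ d != 0,
    forall a, a *: alpha \in N -> a = 0 &
    forall g, g \in gs -> exists a v, v \in N /\ d *: g = a *: alpha + v].
  elim: gs {hgs} => [|g gs [N [d [d0 hN hd]]]].
    by exists (zero_submod M), 1; rewrite oner_neq0; split=> // a /in_zero/ha.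
  have [h|h] := pselect (forall a, a *: alpha \in adjoin N g -> a = 0).
    exists (adjoin N g), d; split=> // g'; rewrite inE => /orP[/eqP->|/hd[a [v [Nv ->]]]].
      by exists 0, (d *: g); rewrite scale0r add0r rpredZ // adjoin_id.
    by exists a, v; split=> //; apply: adjoin_sub.
  have [a [/adjoinP[v [r [Nv aE]]] a0]] : exists a, a *: alpha \in adjoin N g /\ a != 0.
    by apply: contrapT => h'; apply: h => a aN; apply: contrapT => /eqP a0; apply: h'; exists a.
  have r0 : r != 0.
    by apply: contraNneq a0 => r0; apply/eqP/hN; rewrite aE r0 scale0r addr0.
  exists N, (d * r); split=> //; first by rewrite mulf_neq0.
  move=> g'; rewrite inE => /orP[/eqP->|/hd[a' [v' [Nv' E]]]].
    exists (d * a), (- (d *: v)); rewrite submodN ?rpredZ //; split=> //.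
    by rewrite -!scalerA aE scalerDr addrAC subrr add0r.
  exists (r * a'), (r *: v'); rewrite rpredZ //; split=> //.
  by rewrite mulrC -scalerA E scalerDr scalerA.
have WP : submodule_set (fun w : M => exists a v, v \in N /\ d *: w = a *: alpha + v).
  split=> [|r w w' [a [v [Nv E]]] [a' [v' [Nv' E']]]].
    by exists 0, 0; rewrite rpred0 scaler0 scale0r addr0.
  exists (r * a + a'), (r *: v + v'); rewrite rpredD ?rpredZ //; split=> //.
  by rewrite scalerDr scalerA mulrC -scalerA E E' scalerDr scalerDl scalerA addrACA.
have /choice[p hp] : forall w, exists a, exists v, v \in N /\ d *: w = a *: alpha + v.
  move=> w; suff : w \in Submodule WP by move=> /in_SubmoduleP.
  by apply: span_min (hgs w) => g gg; apply/in_SubmoduleP/hd.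
have uniq w a v : v \in N -> d *: w = a *: alpha + v -> p w = a.
  move=> Nv E; have [v' [Nv' E']] := hp w; apply/eqP; rewrite -subr_eq0; apply/eqP/hN.
  rewrite scalerBl (_ : _ - _ = v - v') ?submodB //.
  by apply/eqP; rewrite subr_eq addrAC eq_sym subr_eq -E' E addrC.
have lp : linear (p : M -> R^o).
  move=> r w w'; have [v [Nv E]] := hp w; have [v' [Nv' E']] := hp w'.
  apply: (uniq _ _ (r *: v + v')); first by rewrite rpredD ?rpredZ.
  rewrite scalerDr scalerA mulrC -scalerA E E' scalerDr.
  by rewrite scalerA addrACA -scalerDl.
have [P PE] := linear_map lp; exists P; rewrite PE.
by rewrite (uniq alpha d 0) ?rpred0 ?addr0.
Qed.

Lemma length_adjoin (A : submodClosed M) v z n :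
  (forall b, b *: v \in A -> b \in line (z : R^o)) ->
  length_is (line (z : R^o)) full n -> length_ge n A (adjoin A v).
Proof.
move=> hA [hn _].
have imP (U : submodClosed R^o) : submodule_set (fun w : M => exists2 u : R, u \in U & w = u *: v).
  split=> [|r _ _ [s Us ->] [t Ut ->]]; first by exists 0; rewrite ?ideal0 ?scale0r.
  by exists (r * s + t); rewrite ?scalerDl ?scalerA //; apply: ideal_add => //; apply: ideal_mull.
pose F U := sub_add A (Submodule (imP U)).
have FP (U : submodClosed R^o) w :
    reflect (exists (c : M) (u : R), [/\ c \in A, u \in U & w = c + u *: v]) (w \in F U).
  apply: (iffP (sub_addP _ _ _)) => [[c [_ [Ac /in_SubmoduleP[u Uu ->] ->]]]|[c [u [Ac Uu ->]]]].
    by exists c, u.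
  by exists c, (u *: v); split=> //; apply/in_SubmoduleP; exists u.
have h : length_ge n (F (line (z : R^o))) (F full).
  apply: length_ge_map hn => U U' zU _.
    by move=> UU' _ /FP[c [u [Ac /UU' Uu ->]]]; apply/FP; exists c, u.
  move=> [_ nU'U] h; apply: nU'U => b U'b.
  have /h/FP[c [u [Ac Uu E]]] : (b : R) *: v \in F U'.
    by apply/FP; exists 0, b; rewrite rpred0 add0r.
  have : (b : R) - u \in line (z : R^o).
    by apply: hA; rewrite scalerBl E addrK.
  by move/zU => zb; rewrite -[b](subrK u); apply: ideal_add.
apply: (@length_ge_widenl _ _ _ _ (F (line (z : R^o)))); last first.
  by move=> w Aw; apply: sub_addl Aw.
apply: length_ge_widenr h _ => w /FP[c [u [Ac _ ->]]].
by apply/adjoinP; exists c, u.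
Qed.

(** A functional which is non-zero on [v0] is injective. Otherwise its kernel
    contains some [v] independent of [v0], and the length of [M/yM] would grow at
    least twice as fast as that of [R/yR], contrary to [length_quotient_le]. *)
Lemma embeds_in_ring v0 : finitely_generated M ->
  (forall y v, y != 0 -> y *: v = 0 -> v = 0) ->
  (exists E : injective_resolution M, isomorphic (Ext (quot_mod m) E 1) (quot_mod m)) ->
  v0 != 0 -> exists iota : {linear M -> R^o}, injective iota.
Proof.
move=> fg tf [E ext1] v0n0.
have free v : v != 0 -> forall a, a *: v = 0 -> a = 0.
  move=> vn0 a av; apply: contrapT => /eqP a0; move/eqP: vn0; apply; exact: tf av.
have [p pv0] := torsionless fg (free _ v0n0).
exists p; suff ker v : p v = 0 -> v = 0.
  by move=> u v uv; apply/eqP; rewrite -subr_eq0; apply/eqP/ker; rewrite linearB uv subrr.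
move=> pv; apply: contrapT => /eqP vn0.
have [q qv] := torsionless fg (free _ vn0).
set d : R := p v0 in pv0; set d' : R := q v in qv.
have [x mx x0] := max_nonzero R_noetherian R_local R_dim1.
(* With [D] the product of the two non-zero values, [z = D x] and [y = D z], the
   lower bound, twice the length of [R/z], exceeds the upper bound, the length of
   [R/y], by the length of [R/x]. *)
pose D := d * d'; have D0 : D != 0 by rewrite mulf_neq0.
have [lD hD] := length_exists R_noetherian R_local R_dim1 (line_id (D : R^o)) D0.
have [lx hx] := length_exists R_noetherian R_local R_dim1 (line_id (x : R^o)) x0.
have hz := length_principalM D0 hD hx; set z := D * x in hz.
have hy := length_principalM D0 hD hz; set y := D * z in hy.
have z0 : z != 0 by rewrite mulf_neq0.
have y0 : y != 0 by rewrite mulf_neq0.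
have key a b w : a *: v0 + b *: v = y *: w -> a \in line (z : R^o) /\ b \in line (z : R^o).
  move=> abw.
  have pE : a * d = y * p w.
    have := congr1 (p : M -> R) abw; rewrite linearD !linearZ pv.
    by rewrite -[_ + _]/(a * d + b * 0) mulr0 addr0.
  have qE : a * q v0 + b * d' = y * q w.
    by have := congr1 (q : M -> R) abw; rewrite linearD !linearZ.
  have aE : a = z * (d' * p w).
    by apply: (mulIf pv0); rewrite pE /y /D; ring.
  split; first by apply/pidealP; exists (d' * p w).
  apply/pidealP; exists (d * q w - p w * q v0); apply: (mulIf qv).
  have -> : b * d' = y * q w - a * q v0 by rewrite -qE addrC addKr.
  by rewrite aE /y /D; ring.
pose yM := sub_scale y (full_submod M).
have h1 : length_ge (lx + lD) yM (adjoin yM v).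
  apply: length_adjoin hz => b /sub_scaleP[w _ bv].
  by apply: (proj2 (@key 0 b w _)); rewrite scale0r add0r.
have h2 : length_ge (lx + lD) (adjoin yM v) (adjoin (adjoin yM v) v0).
  apply: length_adjoin hz => a /adjoinP[_ [b [/sub_scaleP[w _ ->] av]]].
  by apply: (proj1 (@key a (- b) w _)); rewrite av scaleNr addrK.
have h3 := length_ge_widenr (length_geD h1 h2) (fun w _ => in_full w).
have := length_quotient_le tf ext1 y0 hy h3.
by have := length_max_pos R_local mx hx; clear; lia.
Qed.

End CanonicalModule.

(** * The conditions of the theorem in terms of the inverse of the ideal *)

Section Duality.
Variables (R : idomainType) (m : submodClosed R^o).
Hypothesis R_noetherian : noetherian R.
Hypothesis R_local : local_ring m.
Hypothesis R_dim1 : krull_dim R = 1%:E.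
Implicit Types (I J : submodClosed R^o) (a b p q r s x : R).
Variable M : lmodType R.
Hypothesis torsion_free : forall a (v : M), a != 0 -> a *: v = 0 -> v = 0.
Variables (x0 : R) (v0 : M).
Hypotheses (mx0 : x0 \in m) (x0_neq0 : x0 != 0) (hv0 : forall u, x0 *: u <> v0).
Hypothesis M_injdim : finite_injective_dim M.

Lemma nonextendable I a s : a \in I -> a != 0 -> s \notin I ->
  exists psi : R -> M, linear_on I psi /\
    forall b w, b \in I -> b != 0 -> b *: w <> s *: psi b.
Proof.
have [E [N hN]] := M_injdim.
exact: (nonextendable_hom R_noetherian R_local R_dim1 torsion_free hN mx0 x0_neq0 hv0).
Qed.

(** This is [M : M = R]: the dual of the principal ideal [bR] distinguishes it
    from any larger ideal. *)
Lemma multiplier_in_ring s b : b != 0 -> (forall w : M, exists u, s *: w = b *: u) ->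
  s \in line (b : R^o).
Proof.
move=> b0 hs; apply: contrapT => /negP ns.
have [psi [_ hpsi]] := nonextendable (line_id (b : R^o)) b0 ns.
have [u uE] := hs (psi b); exact: hpsi (line_id _) b0 (esym uE).
Qed.

(** Non-zero submodules of [M], seen as ideals through [iota], are reflexive for
    the duality with values in [M]. *)
Lemma submodule_dual (iota : {linear M -> R^o}) (N : submodClosed M) n0 u :
  injective iota -> n0 \in N -> n0 != 0 -> u \notin N ->
  exists p q, [/\ q != 0, forall n, n \in N -> exists w, p *: n = q *: w &
    forall w, p *: u <> q *: w].
Proof.
move=> inj Nn0 n00 nu.
have IP : submodule_set (fun r : R^o => exists2 n, n \in N & r = iota n).
  split=> [|a _ _ [n Nn ->] [n' Nn' ->]]; first by exists 0; rewrite ?rpred0 ?linear0.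
  by exists (a *: n + n'); rewrite ?rpredD ?rpredZ // linearP.
pose I := Submodule IP.
have IE r : reflect (exists2 n, n \in N & r = iota n) (r \in I).
  exact: (in_SubmoduleP IP).
pose q : R := iota n0.
have Iq : q \in I by apply/IE; exists n0.
have q0 : q != 0.
  by apply: contraNneq n00 => q0; apply/eqP/inj; rewrite linear0.
have nIu : (iota u : R) \notin I by apply/negP => /IE[n Nn /inj uE]; rewrite uE Nn in nu.
have [psi [lpsi hpsi]] := nonextendable Iq q0 nIu.
have iotaZ a v : iota (a *: v) = a * (iota v : R) :> R by rewrite linearZ.
exists (iota (psi q)), q; split=> // [n Nn|w E].
  exists (psi (iota n)); apply: inj; rewrite !iotaZ mulrC.
  rewrite -!iotaZ; congr (iota _); apply: (linear_on_comm lpsi) => //.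
  by apply/IE; exists n.
apply: (hpsi q w Iq q0); apply: inj.
by rewrite iotaZ mulrC -[LHS]mulrC -iotaZ -E !iotaZ mulrC.
Qed.

End Duality.

Section Characterization.
Variables (R : idomainType) (m : submodClosed R^o).
Hypothesis R_noetherian : noetherian R.
Hypothesis R_local : local_ring m.
Hypothesis R_dim1 : krull_dim R = 1%:E.
Local Notation "x %:F" := (@tofrac R x).
Local Notation Rbar := (@integral_closure R).
Hypothesis Rbar_dvr : is_dvr Rbar.
Variable c0 : R.
Hypotheses (c0_conductor : c0 \in conductor R) (c0_neq0 : c0 != 0).
Implicit Types (I J : submodClosed R^o) (a b c p q r s x : R).

(** Here [a/b] runs through the non-zero elements of the inverse [R : J]. *)
Definition inverse_integral J := forall a b, a != 0 -> b != 0 ->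
  {subset sub_scale a J <= line (b : R^o)} -> Rbar (a%:F / b%:F).

Lemma conductor_mul_integral a b c : b != 0 -> Rbar (a%:F / b%:F) ->
  c \in conductor R -> exists t, a * c = b * t.
Proof.
move=> b0 hab /conductorP/(_ _ hab)[t tE]; exists t; apply: (@tofrac_inj R).
have bF : b%:F != 0 by rewrite tofrac_eq0.
by rewrite !tofracM tE mulrCA (mulrCA b%:F) divff // mulr1 mulrC.
Qed.

(** This is [R : C = Rbar] for the conductor [C]: a fraction multiplying [C] into
    [R] multiplies it into itself, because [C] is an ideal of [Rbar]. *)
Lemma conductor_colon_integral a b : a != 0 -> b != 0 ->
  (forall c, c \in conductor R -> exists t, a * c = b * t) -> Rbar (a%:F / b%:F).
Proof.
move=> a0 b0 hab; have bF : b%:F != 0 by rewrite tofrac_eq0.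
have ab0 : a%:F / b%:F != 0 by rewrite mulf_neq0 ?invr_eq0 ?tofrac_eq0.
have abE c t : a * c = b * t -> t%:F = c%:F * (a%:F / b%:F).
  move=> /(congr1 (@tofrac R)); rewrite !tofracM => E.
  by apply: (mulfI bF); rewrite -E mulrCA (mulrCA b%:F) divff // mulr1 mulrC.
apply: (conductor_stabilizer Rbar_dvr c0_conductor c0_neq0 ab0) => d hd.
have [d' /abE dE] := hab _ hd; exists d' => //; apply/conductorP => beta hbeta.
have [e he eE] := conductorM hd hbeta.
by have [t /abE tE] := hab _ he; exists t; rewrite tE eE dE mulrAC.
Qed.

Lemma h_inv_selfE J x : x \in J -> x != 0 ->
  (h_inv (submod_of J) = mod_length (quot_mod J) <-> inverse_integral J).
Proof.
exact: (h_invE R_noetherian R_local R_dim1 Rbar_dvr c0_conductor c0_neq0).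
Qed.

Lemma inverse_integral_conductor : inverse_integral (conductor R).
Proof.
move=> a b a0 b0 hab; apply: conductor_colon_integral => // c hc.
by apply/pidealP/hab/ideal_scaleP; exists c.
Qed.

Lemma h_inv_conductor :
  h_inv (submod_of (conductor R)) = mod_length (quot_mod (conductor R)).
Proof. exact/(h_inv_selfE c0_conductor c0_neq0)/inverse_integral_conductor. Qed.

(** For every non-zero [x] in [J] the double colon is [R : (R : J)]; it contains
    the conductor [C] if and only if [R : J] is contained in [R : C = Rbar]. *)
Lemma inverse_integral_colon J y : y \in J -> y != 0 ->
  (inverse_integral J <-> exists2 x : R, (x \in J) && (x != 0) &
     forall c : R, c \in conductor R ->
       colon_elt x (colon_elt x (fun r : R => r \in J)) c).
Proof.
move=> Jy y0; split=> [h|[x /andP[Jx x0] h] a b a0 b0 hab].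
  exists y; first by rewrite Jy.
  move=> c hc r hr; have [->|r0] := eqVneq r 0; first by exists 0; rewrite !mulr0.
  have [|t tE] := conductor_mul_integral y0 (h r y r0 y0 _) hc.
    by move=> _ /ideal_scaleP[j /hr[t tE] ->]; apply/pidealP; exists t.
  by exists t; rewrite mulrC.
have hJ j : j \in J -> exists t, a * j = b * t.
  by move=> Jj; apply/pidealP/hab/ideal_scaleP; exists j.
have [r rE] := hJ _ Jx; apply: conductor_colon_integral => // c hc.
have [|t tE] := h c hc r.
  move=> j /hJ[t tE]; exists t; apply: (mulfI b0).
  by rewrite mulrA -rE mulrAC tE -mulrA (mulrC t).
exists t; apply: (mulfI x0).
by rewrite mulrA (mulrC x a) rE -mulrA (mulrC r c) tE mulrCA.
Qed.

Section Canonical.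
Variable M : lmodType R.
Hypothesis torsion_free : forall a (v : M), a != 0 -> a *: v = 0 -> v = 0.
Variables (x0 : R) (v0 : M).
Hypotheses (mx0 : x0 \in m) (x0_neq0 : x0 != 0) (hv0 : forall u, x0 *: u <> v0).
Hypothesis M_injdim : finite_injective_dim M.

(** The dual [M : J M] of [J M] is [R : J], because [M : M = R], and likewise the dual
    of [C M] is [R : C = Rbar] for the conductor [C]; by duality, [C M] is contained
    in [J M] if and only if [R : J] is contained in [Rbar]. *)
Lemma inverse_integral_canonical (iota : {linear M -> R^o}) J y :
  injective iota -> y \in J -> y != 0 ->
  (inverse_integral J <->
   {subset ideal_mul (conductor R) (full_submod M) <= ideal_mul J (full_submod M)}).
Proof.
move=> inj Jy y0.
have in_ring := multiplier_in_ring R_noetherian R_local R_dim1 torsion_free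
  mx0 x0_neq0 hv0 M_injdim.
split=> [h|h a b a0 b0 hab].
  apply: span_min => _ [c [w [hc _ ->]]]; apply: contrapT => /negP nJ.
  have v0_neq0 : v0 != 0.
    by apply/eqP => v00; apply: (hv0 (u := 0)); rewrite scaler0.
  have JM j v : j \in J -> j *: v \in ideal_mul J (full_submod M).
    by move=> Jj; apply: span_gen; exists j, v; split=> //; apply: in_full.
  have yv0 : y *: v0 != 0.
    by apply: contraNneq v0_neq0 => /(torsion_free y0) ->.
  have [p [q [q0 hN hcw]]] := submodule_dual R_noetherian R_local R_dim1 torsion_free
    mx0 x0_neq0 hv0 M_injdim inj (JM _ v0 Jy) yv0 nJ.
  have p0 : p != 0.
    by apply/eqP => p0; apply: (hcw 0); rewrite p0 scale0r scaler0.
  have hpq : Rbar (p%:F / q%:F).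
    apply: h => // _ /ideal_scaleP[j Jj ->]; apply: in_ring => // v.
    by have [u uE] := hN _ (JM _ v Jj); exists u; rewrite -scalerA.
  have [t tE] := conductor_mul_integral q0 hpq hc.
  by apply: (hcw (t *: w)); rewrite !scalerA tE.
apply: conductor_colon_integral => // c hc; apply/pidealP/in_ring => // w.
have UP : submodule_set (fun v : M => exists u, a *: v = b *: u).
  split=> [|r u v [u' uE] [v' vE]]; first by exists 0; rewrite !scaler0.
  by exists (r *: u' + v'); rewrite !scalerDr vE !scalerA (mulrC a) (mulrC b) -!scalerA uE.
rewrite -scalerA; apply/(in_SubmoduleP UP); apply: (@span_min _ _ _ (Submodule UP)); last first.
  by apply: h; apply: span_gen; exists c, w; split=> //; apply: in_full.
move=> _ [j [v [Jj _ ->]]]; apply/in_SubmoduleP.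
have /hab/pidealP[t tE] : a * j \in sub_scale a J by apply/ideal_scaleP; exists j.
by exists (t *: v); rewrite !scalerA tE.
Qed.

End Canonical.

Section Gorenstein.
Hypothesis R_gorenstein : gorenstein R.

(** Over a Gorenstein ring the duality applies with values in [R], and non-zero
    ideals are reflexive: [J = R : (R : J)] contains [R : Rbar], the conductor. *)
Lemma gorenstein_conductor_sub J y : y \in J -> y != 0 -> inverse_integral J ->
  {subset conductor R <= J}.
Proof.
move=> Jy y0 h c hc; apply: contrapT => /negP nJc.
have [x mx x0] := max_nonzero R_noetherian R_local R_dim1.
have tf (a : R) (v : R^o) : a != 0 -> a *: v = 0 -> v = 0.
  by move=> a0 /eqP; rewrite mulf_eq0 (negPf a0) => /eqP.
have hx (u : R^o) : x *: u <> 1.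
  move=> xu; have /negP := max_proper R_local; apply.
  by rewrite -xu; apply: ideal_mulr.
have [psi [lpsi hpsi]] := nonextendable R_noetherian R_local R_dim1 tf mx x0 hx
  R_gorenstein Jy y0 nJc.
pose p : R := psi y.
have p0 : p != 0.
  by apply/eqP => p0; apply: (hpsi y 0 Jy y0); rewrite -/p p0 !scaler0.
have hpy : Rbar (p%:F / y%:F).
  apply: h => // _ /ideal_scaleP[j Jj ->]; apply/pidealP; exists (psi j).
  by rewrite mulrC; apply: (linear_on_comm lpsi).
have [t tE] := conductor_mul_integral y0 hpy hc.
by apply: (hpsi y t Jy y0); rewrite -[RHS]/(c * p) mulrC tE.
Qed.

Lemma positive_rank_free (M : lmodType R) : (0 < mod_rank M)%E ->
  exists v : M, forall a, a *: v = 0 -> a = 0.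
Proof.
move=> hr; apply: contrapT => h; move: hr; apply/negP; rewrite -leNgt.
apply: nat_sup_le; first by exists 0%N, (fun _ => 0) => a _ [].
move=> [//|n] [v hv]; exfalso; apply: h; exists (v ord0) => a av.
have := hv (fun i => if i == ord0 then a else 0); rewrite big_ord_recl /= av.
rewrite big1 ?addr0 => [/(_ erefl ord0) //|i _].
by rewrite scale0r.
Qed.

(** The ideal [I] is the image of a homomorphism from [M] to [R] of least colength.
    Homomorphisms from [I] to [R] compose with it, so their images have no smaller
    colength. *)
Lemma realizing_ideal (M : lmodType R) : finitely_generated M -> (0 < mod_rank M)%E ->
  exists I, [/\ exists2 x : R, x \in I & x != 0, h_inv M = mod_length (quot_mod I) &
    h_inv (submod_of I) = mod_length (quot_mod I)].
Proof.
move=> fg /positive_rank_free[v hv]; have [p pv] := torsionless fg hv.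
have [phi [hphi phimin]] := h_inv_attained M.
pose I := lin_image phi.
have [x Ix x_neq0] : exists2 x : R, x \in I & x != 0.
  apply: contrapT => nI.
  have I0 (y : R) : y \in I -> y = 0.
    by move=> Iy; apply: contrapT => /eqP y0; apply: nI; exists y.
  have ppv : (p v : R) \in lin_image p by apply/lin_imageP; exists v.
  have [n hn] := length_exists R_noetherian R_local R_dim1 ppv pv.
  have := phimin p; rewrite (mod_length_quotE hn).
  have [->//|[k hk ->]] := mod_length_quot_dichotomy I.
  rewrite lee_fin lez_nat leqNgt => /negP; apply.
  apply/(length_isP hk); rewrite -add1n; apply: length_geD (proj1 hn).
  exists I; first by [].
  apply: submod_lt_witness ppv _ => [y /I0 ->|]; first exact: ideal0.
  by apply/negP => /I0/eqP; rewrite (negPf pv).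
exists I; split=> //; first by exists x.
apply/h_invP; split.
  have lv : linear (fun j : submod_of I => \val j : R^o) by [].
  have [i iE] := linear_map lv; exists i; apply/eqP; rewrite eq_le; apply/andP; split.
    apply: mod_length_quot_le => _ /lin_imageP[j <-]; rewrite iE; exact: valP.
  by apply: mod_length_quot_le => y Iy; apply/lin_imageP; exists (exist _ y Iy); rewrite iE.
move=> psi.
have phiI w : phi w \in I by apply/lin_imageP; exists w.
have lc : linear (fun w => psi (exist _ (phi w) (phiI w))).
  move=> r w w'; rewrite -linearP; congr (psi _); apply: val_inj => /=.
  by rewrite linearP.
have [chi chiE] := linear_map lc.
apply: le_trans (phimin chi) _; apply: mod_length_quot_le => _ /lin_imageP[[y Iy] <-].
have /lin_imageP[w wE] := Iy; apply/lin_imageP; exists w; rewrite chiE.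
by congr (psi _); apply: val_inj.
Qed.

End Gorenstein.

End Characterization.

Theorem theorem2p10 (R : idomainType) (m : submodClosed R^o)
    (omega : lmodType R)
    (R_noetherian : noetherian R)
    (R_local : local_ring m)
    (R_dim1 : krull_dim R = 1%:E)
    (R_completion_reduced : reduced (completion m))
    (Rbar_dvr : is_dvr (@integral_closure R))
    (omega_canonical : canonical_module m omega) :
  (forall J : submodClosed R^o, (exists2 x : R, x \in J & x != 0) ->
     (h_inv (submod_of J) = mod_length (quot_mod J) <->
      exists2 x : R, (x \in J) && (x != 0) &
        forall c : R, c \in conductor R ->
          colon_elt x (colon_elt x (fun r : R => r \in J)) c)
     /\
     (h_inv (submod_of J) = mod_length (quot_mod J) <->
      {subset ideal_mul (conductor R) (full_submod omega)
         <= ideal_mul J (full_submod omega)}))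
  /\
  (gorenstein R ->
     (forall J : submodClosed R^o, (exists2 x : R, x \in J & x != 0) ->
        h_inv (submod_of J) = mod_length (quot_mod J) ->
        {subset conductor R <= J})
     /\
     (forall M : lmodType R, finitely_generated M -> (0 < mod_rank M)%E ->
        (h_inv M <= h_inv (submod_of (conductor R)))%E)
     /\
     h_inv (submod_of (conductor R)) = mod_length (quot_mod (conductor R))).
Proof.
have [c0 hc0 c0n0] := conductor_nonzero R_noetherian R_local R_dim1 R_completion_reduced.
have selfE J x := @h_inv_selfE R m R_noetherian R_local R_dim1 Rbar_dvr c0 hc0 c0n0 J x.
split=> [J [x Jx x0]|gor].
  rewrite !(selfE J x Jx x0); split.
    exact: (inverse_integral_colon Rbar_dvr hc0 c0n0 Jx x0).
  have [[fg depth_omega] [t depth_t ext_t] injdim] := omega_canonical.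
  have depth1 : depth m omega = 1%:E by rewrite depth_omega.
  have t1 : t = 1%N by move: depth_t; rewrite depth1 => -[].
  have [E [N hN]] := injdim.
  have [y [my y0 yreg [v0 hv0]]] := depth_one depth1.
  have tf := regular_torsion_free R_noetherian R_local R_dim1 my yreg.
  have v00 : v0 != 0 by apply/eqP => v00; apply: (hv0 0); rewrite scaler0.
  have [|iota inj] := embeds_in_ring R_noetherian R_local R_dim1 fg tf _ v00.
    by exists E; have := ext_t E; rewrite t1.
  exact: (inverse_integral_canonical R_noetherian R_local R_dim1 Rbar_dvr hc0 c0n0
    tf my y0 hv0 injdim inj Jx x0).
have hconductor := h_inv_conductor R_noetherian R_local R_dim1 Rbar_dvr hc0 c0n0.
have sub (J : submodClosed R^o) : (exists2 x : R, x \in J & x != 0) ->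
    h_inv (submod_of J) = mod_length (quot_mod J) -> {subset conductor R <= J}.
  move=> [x Jx x0] /(selfE J x Jx x0).
  exact: (gorenstein_conductor_sub R_noetherian R_local R_dim1 gor Jx x0).
split=> //; split=> // M fg rk.
have [I [I0 -> hI]] := realizing_ideal R_noetherian R_local R_dim1 fg rk.
by rewrite hconductor; apply: mod_length_quot_le; apply: sub.
Qed.
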